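(* Suppose that Assumptions A, B and C of the context hold, and let $\{x^k\}$ be generated by the algorithm sMBA described in the context. Let $\epsilon_1>0$ and $\epsilon_2>0$. With $S_K=\sum_{k=\lceil K/2\rceil}^{K}\mu_k$, with $\psi^*$ the optimal value of problem (P), and with the constants $M_\lambda,\bar M_1,\bar M_2$ defined in the context, suppose that $K\in\mathbb N_0$ satisfies $$S_K\ge\bar M_1(\psi(x^0)-\psi^* )\epsilon_1^{-2}\quad\text{and}\quad \mu_{\lceil K/2\rceil}\le\min\left\{\frac{\bar M_1}{\alpha_3\bar M_1M_\lambda+\bar M_2\epsilon_1^2},\ \frac{\tau_1\bar M_1}{2}\right\}\epsilon_2 .$$ Then there exists an integer $\hat k\in[\lceil K/2\rceil,K]$ such that $x^{\hat k+1}$ is an $(\epsilon_1,\epsilon_2,\epsilon_1\sqrt{\epsilon_2})$-KKT point of problem (P).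
   Context: **Notation.** $\mathbb X,\mathbb Y$ are finite-dimensional real Hilbert spaces; $\mathbb N_0=\mathbb N\cup\{0\}$ with $\mathbb N=\{1,2,\dots\}$; $B(x,r)$ is the closed ball. For a cone $\mathcal K\subseteq\mathbb Y$, $\mathcal K^\circ=\{y:\langle y,w\rangle\le0\ \forall w\in\mathcal K\}$. A map is $L$-smooth if it is continuously differentiable with $L$-Lipschitz derivative; $DG(x)$ is the derivative of $G$, $DG(x)^*$ its adjoint, $\|DG(x)\|$ its operator norm. $\partial$ is the convex subdifferential. $\sigma_{\mathcal C}(y)=\sup_{u\in\mathcal C}\langle y,u\rangle$ is the support function. A base of a cone $\mathcal Q$ is a convex set $\mathcal D$ with $0\notin\mathrm{cl}(\mathcal D)$ and $\mathcal Q=\bigcup_{t\ge0}t\mathcal D$. **Problem (P).** Minimize $\psi(x):=f(x)+P_1(x)-P_2(x)$ over $x\in\mathbb X$ subject to $G(x)\in\mathcal K$. **Approximate KKT points.** For $\epsilon_1,\epsilon_2,\epsilon_3\ge0$, $x\in G^{-1}(\mathcal K)$ is an $(\epsilon_1,\epsilon_2,\epsilon_3)$-KKT point of (P) if there exist $z\in G^{-1}(\mathcal K)$ and $v\in\mathcal K^\circ$ such that $\mathrm{dist}(0,\partial P_1(x)-\partial P_2(z)+\nabla f(x)+DG(x)^*v)\le\epsilon_1$, $-\langle v,G(x)\rangle\le\epsilon_2$ and $\|x-z\|\le\epsilon_3$. **Assumption A.** (i) $\mathcal K\subseteq\mathbb Y$ is a closed convex pointed cone with nonempty interior. (ii) $f:\mathbb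 X\to\mathbb R$ is $L_f$-smooth and $G:\mathbb X\to\mathbb Y$ is $L_G$-smooth, $L_f>0$, $L_G\ge0$. (iii) $P_1,P_2:\mathbb X\to\mathbb R$ are convex. (iv) There is $x^0\in\mathbb X$ with $G(x^0)\in\mathrm{int}(\mathcal K)$ such that $\Omega_0:=\{x:\psi(x)\le\psi(x^0),\ G(x)\in\mathcal K\}$ is bounded. (v) (Robinson's constraint qualification) $0\in\mathrm{int}(G(x)+DG(x)\mathbb X-\mathcal K)$ for all $x\in\Omega_0$. $\mathcal B$ is a fixed compact base of $\mathcal K^\circ$ (one exists), and $g_{\mathcal B}(x):=\sigma_{\mathcal B}(G(x))$. **Assumption B.** There are $\alpha_1\ge0$, $\alpha_2,\alpha_3,\alpha_4>0$ and a family $\{h_\mu\}_{\mu>0}$ of convex $C^1$ functions on $\mathbb Y$ such that for every $\mu>0$, $\nabla h_\mu$ is $(\alpha_1+\alpha_2/\mu)$-Lipschitz and $\sigma_{\mathcal B}(y)\le h_\mu(y)\le\sigma_{\mathcal B}(y)+\alpha_3\mu$ for all $y\in\mathbb Y$; and $h_{\mu_1}(y)\le h_{\mu_0}(y)-\alpha_4(\mu_0-\mu_1)$ for all $y\in\mathbb Y$ and $\mu_0>\mu_1>0$. Put $g_\mu(x):=h_\mu(G(x))$. **Assumption C.** The sequence $\{\mu_k\}_{k\in\mathbb N_0}$ used in the algorithm is positive, strictly decreasing, $\mu_k\to0$, and $S_K:=\sum_{k=\lceil K/2\rceil}^K\mu_k\to\infty$ as $K\to\infty$. **Algorithm sMBA.**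 Input: $\tau_1,\tau_2>0$, $\hat L\ge\check L>0$, the point $x^0$ of Assumption A(iv), the family $\{h_\mu\}$. Step 1: find $\mu_0>0$ with $g_{\mu_0}(x^0)<0$; set $k=0$. Step 2: choose $\xi^k\in\partial P_2(x^k)$ and $L_f^{k,0},L_g^{k,0}\in[\check L,\hat L]$; set $i=j=0$. Step 3: set $L_f^{k,i}=2^iL_f^{k,0}$, $L_g^{k,j}=2^jL_g^{k,0}$; let $x^{k,i,j}$ be the unique solution, and $\lambda_{k,i,j}\ge0$ a Lagrange multiplier, of the problem of minimizing $\psi_{k,i}(x):=P_1(x)+\langle\nabla f(x^k)-\xi^k,x-x^k\rangle+\frac{L_f^{k,i}}2\|x-x^k\|^2$ subject to $g_{k,j}(x):=g_{\mu_k}(x^k)+\langle\nabla g_{\mu_k}(x^k),x-x^k\rangle+\frac{L_g^{k,j}}{2\mu_k}\|x-x^k\|^2\le0$. Step 4: if $g_{\mu_k}(x^{k,i,j})\le0$ and $\psi(x^{k,i,j})\le\psi(x^k)-\frac{\tau_1\mu_k+\tau_2\lambda_{k,i,j}}{2\mu_k}\|x^{k,i,j}-x^k\|^2$, set $i_k=i$, $j_k=j$ and go to Step 5; else if $g_{\mu_k}(x^{k,i,j})>0$, set $j\leftarrow j+1$ and go to Step 3; else set $i\leftarrow i+1$, $j\leftarrow j+1$ and go to Step 3. Step 5: set $x^{k+1}=x^{k,i_k,j_k}$, $\lambda_{k+1}=\lambda_{k,i_k,j_k}$, $L_f^k=L_f^{k,i_k}$, $L_g^k=L_g^{k,j_k}$;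 choose $\mu_{k+1}\in(0,\mu_k)$; $k\leftarrow k+1$; go to Step 2. **Constants.** $M_{\mathcal B}=\sup_{u\in\mathcal B}\|u\|$; $M_G=\sup_{x\in\Omega_0}\|DG(x)\|$; $g^*_{\mathcal B}=\inf_{x\in\Omega_0}g_{\mathcal B}(x)$; $M_R=\sqrt{\mu_0^2\check L^{-2}M_G^2M_{\mathcal B}^2-2\mu_0\check L^{-1}g^*_{\mathcal B}}+\mu_0\check L^{-1}M_GM_{\mathcal B}$; $\hat\Omega_0=\Omega_0+B(0,M_R)$; $\hat M_G=\sup\{\|DG(x)\|:x\in\mathrm{conv}(\hat\Omega_0)\}$; $L_\mu=M_{\mathcal B}L_G+\alpha_1\hat M_G^2+\alpha_2\hat M_G^2/\mu$; $M_L=\hat L\max\{2,2(L_f+\tau_1)/\check L\}\max\{2,2\tau_2/\check L,2\mu_0L_{\mu_0}/\check L\}$. $M_f=\sup_{x\in\Omega_0}\|\nabla f(x)\|$; $M_{P_1}=\sup_{x\in\hat\Omega_0}\{\|\zeta\|:\zeta\in\partial P_1(x)\}$; $M_{P_2}=\sup_{x\in\Omega_0}\{\|\xi\|:\xi\in\partial P_2(x)\}$. $\eta>0$ is a constant (one exists) such that for no $(x,u)\in\Omega_0\times\mathcal B$ do both $\|DG(x)^*u\|^2\le\eta$ and $-\langle u,G(x)\rangle\le\eta$ hold. $\bar t$ is the first positive integer with $\mu_{\bar t}<\eta/(2\alpha_3)$; $c_0=\min\{\mu_{t-1}/\mu_t-1:t=1,\dots,\bar t\}$; $\bar\eta=\sqrt{\min\{\eta,\,2\alpha_3\check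 L,\,-2\mu_0^{-1}\check Lg_{\mu_0}(x^0),\,2c_0\alpha_4\check L\}}$; $M_\lambda=\frac{M_f+M_{P_1}+M_{P_2}}{\bar\eta}+\frac{M_LM_G^2M_{\mathcal B}^2\mu_0}{2\check L\bar\eta^2}$; $\bar M_1=16M_L^2\max\{\mu_0/\tau_1,M_\lambda/\tau_2\}$; $\bar M_2=(M_L+\mu_0L_GM_{\mathcal B})/\tau_2$. *)

(* Defs.v *)
From HB Require Import structures.
From mathcomp Require Import all_boot all_order all_algebra.
From mathcomp Require Import all_classical all_reals all_analysis.

Set Implicit Arguments.
Unset Strict Implicit.
Unset Printing Implicit Defensive.

Import Order.TTheory GRing.Theory Num.Theory.
Import numFieldNormedType.Exports.

Local Open Scope classical_set_scope.
Local Open Scope ring_scope.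

(* Completeness is automatic in finite dimension, and positive definiteness of
   the inner product follows from [inner_normE]. *)
HB.mixin Record NormedModule_hasInner (R : realType) (V : Type)
    of NormedModule R V & Vector R V := {
  inner : V -> V -> R ;
  innerC : forall x y : V, inner x y = inner y x ;
  innerDl : forall x y z : V, inner (x + y) z = inner x z + inner y z ;
  innerZl : forall (a : R) (x y : V), inner (a *: x) y = a * inner x y ;
  inner_normE : forall x : V, inner x x = `|x| ^+ 2
}.

#[short(type="finHilbertType")]
HB.structure Definition FinHilbert (R : realType) :=
  {V of NormedModule R V & Vector R V & NormedModule_hasInner R V}.

Section Operators.
Context {R : realType}.

(* The supremum over the closed unit ball, which is the operator norm when [A]
   is linear and continuous. *)
Definition opnorm {V W : normedModType R} (A : V -> W) : R :=
  sup [set `|A v| | v in [set v : V | `|v| <= 1]].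

Definition C1 {V W : normedModType R} (F : V -> W) :=
  (forall x, differentiable F x) /\
  (forall x, opnorm (fun v => 'd F y v - 'd F x v) @[y --> x] --> (0 : R)).

Definition smooth {V W : normedModType R} (L : R) (F : V -> W) :=
  C1 F /\
  (forall x y, opnorm (fun v => 'd F x v - 'd F y v) <= L * `|x - y|).

(* [grad] and [adjoint] pick the (unique) representing vector given by the
   Riesz theorem. *)
Definition grad {V : finHilbertType R} (F : V -> R) (x : V) : V :=
  get [set w : V | forall v, 'd F x v = inner w v].

Definition adjoint {V W : finHilbertType R} (A : V -> W) (w : W) : V :=
  get [set u : V | forall v, inner (A v) w = inner v u].

Definition subdiff {V : finHilbertType R} (P : V -> R) (x : V) : set V :=
  [set zeta | forall y, P x + inner zeta (y - x) <= P y].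

Definition support_fun {V : finHilbertType R} (C : set V) (y : V) : R :=
  sup [set inner y u | u in C].

Definition convex_hull {V : lmodType R} (A : set V) : set V :=
  smallest (@convex_set R V) A.

Definition is_cone {V : lmodType R} (Q : set V) :=
  forall (t : R) (y : V), 0 <= t -> Q y -> Q (t *: y).

Definition pointed_cone {V : lmodType R} (Q : set V) :=
  Q `&` [set - y | y in Q] = [set 0].

Definition polar {V : finHilbertType R} (Q : set V) : set V :=
  [set y | forall w, Q w -> inner y w <= 0].

Definition is_base {V : normedModType R} (Q D : set V) :=
  [/\ @convex_set R V D, ~ closure D 0
    & Q = \bigcup_(t in [set t : R | 0 <= t]) [set t *: d | d in D]].

End Operators.

Record problem (R : realType) (X Y : finHilbertType R) := Problem {
  f_of : X -> R ;
  P1_of : X -> R ;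
  P2_of : X -> R ;
  G_of : X -> Y ;
  K_of : set Y
}.

Section Problem.
Context {R : realType} {X Y : finHilbertType R} (p : problem X Y).
Local Notation f := (f_of p).
Local Notation P1 := (P1_of p).
Local Notation P2 := (P2_of p).
Local Notation G := (G_of p).
Local Notation K := (K_of p).

Definition psi (x : X) : R := f x + P1 x - P2 x.

Definition feasible : set X := G @^-1` K.

Definition optval : R := inf (psi @` feasible).

Definition Omega0 (x0 : X) : set X :=
  [set x | psi x <= psi x0 /\ feasible x].

(* [edist_inf A 0] is the extended-real distance from [0] to [A], equal to
   [+oo] when [A] is empty. *)
Definition kkt_point (x : X) (e1 e2 e3 : R) :=
  feasible x /\
  exists (z : X) (v : Y),
    [/\ feasible z, polar K v,
        (edist_inf [set (a - b + grad f x + adjoint ('d G x) v)%R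
                   | a in subdiff P1 x & b in subdiff P2 z] 0%R <= e1%:E)%E,
        - inner v (G x) <= e2
      & `|x - z| <= e3].

Definition robinson (x : X) :=
  interior [set G x + 'd G x d - w | d in setT & w in K] 0.

Record assumptionA (Lf LG : R) (x0 : X) : Prop := AssumptionA {
  A_cone : is_cone K ;
  A_closed : closed K ;
  A_convex : @convex_set R Y K ;
  A_pointed : pointed_cone K ;
  A_interior : interior K !=set0 ;
  A_Lf : 0 < Lf ;
  A_LG : 0 <= LG ;
  A_f : smooth Lf f ;
  A_G : smooth LG G ;
  A_P1 : @convex_function R X setT P1 ;
  A_P2 : @convex_function R X setT P2 ;
  A_slater : interior K (G x0) ;
  A_bounded : bounded_set (Omega0 x0) ;
  A_robinson : forall x, Omega0 x0 x -> robinson x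
}.

End Problem.

(* Only the values [h_of s mu] with [0 < mu] are meaningful. *)
Record smoothing (R : realType) (Y : finHilbertType R) := Smoothing {
  alpha1 : R ;
  alpha2 : R ;
  alpha3 : R ;
  alpha4 : R ;
  h_of : R -> Y -> R
}.

Record assumptionB (R : realType) (Y : finHilbertType R) (B : set Y)
    (s : smoothing Y) : Prop := AssumptionB {
  B_alpha1 : 0 <= alpha1 s ;
  B_alpha2 : 0 < alpha2 s ;
  B_alpha3 : 0 < alpha3 s ;
  B_alpha4 : 0 < alpha4 s ;
  B_convex : forall mu : R, 0 < mu -> @convex_function R Y setT (h_of s mu) ;
  B_C1 : forall mu : R, 0 < mu -> C1 (h_of s mu) ;
  B_lipschitz : forall mu : R, 0 < mu ->
    (alpha1 s + alpha2 s / mu).-lipschitz (grad (h_of s mu)) ;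
  B_approx : forall (mu : R) (y : Y), 0 < mu ->
    support_fun B y <= h_of s mu y <= support_fun B y + alpha3 s * mu ;
  B_monotone : forall (mu1 mu0 : R) (y : Y), 0 < mu1 -> mu1 < mu0 ->
    h_of s mu1 y <= h_of s mu0 y - alpha4 s * (mu0 - mu1)
}.

(* [uphalf K] is the ceiling of K / 2. *)
Definition S_ (R : realType) (mu : nat -> R) (K : nat) : R :=
  \sum_(uphalf K <= k < K.+1) mu k.

Record assumptionC (R : realType) (mu : nat -> R) : Prop := AssumptionC {
  C_pos : forall k, 0 < mu k ;
  C_decr : forall k, mu k.+1 < mu k ;
  C_lim : mu @ \oo --> (0 : R) ;
  C_sum : S_ mu K @[K --> \oo] --> +oo
}.

Record params (R : realType) := Params {
  tau1 : R ;
  tau2 : R ;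
  Lhat : R ;
  Lcheck : R
}.

Definition valid_params (R : realType) (q : params R) :=
  [/\ 0 < tau1 q, 0 < tau2 q, 0 < Lcheck q & Lcheck q <= Lhat q].

Section Algorithm.
Context {R : realType} {X Y : finHilbertType R}.
Variables (p : problem X Y) (s : smoothing Y) (q : params R).

Definition gmu (mu : R) (x : X) : R := h_of s mu (G_of p x).

Definition psi_sub (xk xi : X) (Lf : R) (x : X) : R :=
  P1_of p x + inner (grad (f_of p) xk - xi) (x - xk)
  + Lf / 2 * `|x - xk| ^+ 2.

Definition g_sub (mu : R) (xk : X) (Lg : R) (x : X) : R :=
  gmu mu xk + inner (grad (gmu mu) xk) (x - xk)
  + Lg / (2 * mu) * `|x - xk| ^+ 2.

Definition is_minimizer (F g : X -> R) (x : X) :=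
  g x <= 0 /\ (forall y, g y <= 0 -> F x <= F y).

(* The Karush-Kuhn-Tucker conditions for a convex [F] and a differentiable
   convex [g]. *)
Definition is_multiplier (F g : X -> R) (x : X) (lambda : R) :=
  [/\ 0 <= lambda, lambda * g x = 0
    & exists2 zeta, subdiff F x zeta & zeta + lambda *: grad g x = 0].

Definition accepted (mu : R) (xk x : X) (lambda : R) :=
  gmu mu x <= 0 /\
  psi p x <= psi p xk
    - (tau1 q * mu + tau2 q * lambda) / (2 * mu) * `|x - xk| ^+ 2.

(* The pairs (i, j) of backtracking counters met by the inner loop, where
   [xt i j] and [lam i j] are the trial point and its multiplier. *)
Inductive visited (mu : R) (xk : X) (xt : nat -> nat -> X)
    (lam : nat -> nat -> R) : nat -> nat -> Prop :=
| visited_start : visited mu xk xt lam 0 0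
| visited_infeasible i j :
    visited mu xk xt lam i j -> ~ accepted mu xk (xt i j) (lam i j) ->
    0 < gmu mu (xt i j) -> visited mu xk xt lam i j.+1
| visited_no_descent i j :
    visited mu xk xt lam i j -> ~ accepted mu xk (xt i j) (lam i j) ->
    ~ (0 < gmu mu (xt i j)) -> visited mu xk xt lam i.+1 j.+1.

(* One outer iteration from [xk] to [xk1]: the inner loop stops at (ik, jk).
   Trial points and multipliers are constrained only at the visited pairs, the
   only ones for which the algorithm solves a subproblem. *)
Definition smba_step (mu : R) (xk xk1 : X) : Prop :=
  exists (xi : X) (Lf0 Lg0 : R) (xt : nat -> nat -> X) (lam : nat -> nat -> R)
         (ik jk : nat),
    [/\ subdiff (P2_of p) xk xi,
        Lcheck q <= Lf0 <= Lhat q /\ Lcheck q <= Lg0 <= Lhat q,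
        forall i j, visited mu xk xt lam i j ->
          let F := psi_sub xk xi (2 ^+ i * Lf0) in
          let g := g_sub mu xk (2 ^+ j * Lg0) in
          is_minimizer F g (xt i j) /\ is_multiplier F g (xt i j) (lam i j),
        visited mu xk xt lam ik jk /\
          accepted mu xk (xt ik jk) (lam ik jk)
      & xk1 = xt ik jk].

Definition smba_run (x0 : X) (mu : nat -> R) (x : nat -> X) : Prop :=
  [/\ x 0%N = x0, 0 < mu 0%N, gmu (mu 0%N) x0 < 0
    & forall k, smba_step (mu k) (x k) (x k.+1) /\ 0 < mu k.+1 < mu k].

End Algorithm.

(* Under the standing assumptions each [sup] and [inf] below, as well as
   [optval] above, is taken over a nonempty set that is bounded on the relevant
   side, so that it is the supremum or infimum of the text. *)
Section Constants.
Context {R : realType} {X Y : finHilbertType R}.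
Variables (p : problem X Y) (Lf LG : R) (x0 : X) (B : set Y).
Variables (s : smoothing Y) (q : params R) (mu : nat -> R).
Variables (eta : R) (tbar : nat).
Local Notation f := (f_of p).
Local Notation G := (G_of p).
Local Notation Om0 := (Omega0 p x0).
Local Notation mu0 := (mu 0%N).
Local Notation Lc := (Lcheck q).
Local Notation max := Num.max.

Definition M_B : R := sup [set `|u| | u in B].
Definition M_G : R := sup [set opnorm ('d G x) | x in Om0].
Definition g_B (x : X) : R := support_fun B (G x).
Definition g_B_inf : R := inf [set g_B x | x in Om0].

Definition M_R : R :=
  Num.sqrt (mu0 ^+ 2 / Lc ^+ 2 * M_G ^+ 2 * M_B ^+ 2 - 2 * mu0 / Lc * g_B_inf)
  + mu0 / Lc * M_G * M_B.

Definition Omega0_hat : set X :=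
  [set x + v | x in Om0 & v in [set v : X | `|v| <= M_R]].

Definition M_G_hat : R := sup [set opnorm ('d G x) | x in convex_hull Omega0_hat].

Definition L_ (m : R) : R :=
  M_B * LG + alpha1 s * M_G_hat ^+ 2 + alpha2 s * M_G_hat ^+ 2 / m.

Definition M_L : R :=
  Lhat q * max 2 (2 * (Lf + tau1 q) / Lc)
  * max (max 2 (2 * tau2 q / Lc)) (2 * mu0 * L_ mu0 / Lc).

Definition M_f : R := sup [set `|grad f x| | x in Om0].

Definition M_P1 : R :=
  sup [set `|zeta| | zeta in \bigcup_(x in Omega0_hat) subdiff (P1_of p) x].

Definition M_P2 : R :=
  sup [set `|xi| | xi in \bigcup_(x in Om0) subdiff (P2_of p) x].

Definition eta_spec : Prop :=
  0 < eta /\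
  (forall (x : X) (u : Y), Om0 x -> B u ->
    ~ (`|adjoint ('d G x) u| ^+ 2 <= eta /\ - inner u (G x) <= eta)).

Definition tbar_spec : Prop :=
  [/\ (0 < tbar)%N, mu tbar < eta / (2 * alpha3 s)
    & forall t, (0 < t < tbar)%N -> eta / (2 * alpha3 s) <= mu t].

(* The minimum over t = 1, ..., tbar; the default value is the term t = 1. *)
Definition c0 : R :=
  \big[Num.min/mu 0%N / mu 1%N - 1]_(1 <= t < tbar.+1) (mu t.-1 / mu t - 1).

Definition eta_bar : R :=
  Num.sqrt (Num.min (Num.min eta (2 * alpha3 s * Lc))
                    (Num.min (- 2 * mu0^-1 * Lc * gmu p s mu0 x0)
                             (2 * c0 * alpha4 s * Lc))).

Definition M_lambda : R :=
  (M_f + M_P1 + M_P2) / eta_bar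
  + M_L * M_G ^+ 2 * M_B ^+ 2 * mu0 / (2 * Lc * eta_bar ^+ 2).

Definition M1_bar : R :=
  16 * M_L ^+ 2 * max (mu0 / tau1 q) (M_lambda / tau2 q).

Definition M2_bar : R := (M_L + mu0 * LG * M_B) / tau2 q.

End Constants.

(* Main.v *)
(* At an iterate [x'] obtained from [x], with step [d = x' - x], take the
   multiplier [v = lambda * grad h_mu (G x)] and the reference point [z = x].
   Since [h_mu] exceeds the support function of [B] by at most a constant, its
   gradients lie in [B], hence [v] lies in the polar cone, and smoothness bounds
   the stationarity and complementarity residuals by multiples of [|d|] and
   [|d|^2 + mu].  The multiples are controlled by [M_L] and [M_lambda]: backtracking
   cannot fail once the two parameters pass fixed thresholds, and the gradient of
   an active constraint at [x'] has norm at least [eta_bar], which bounds [lambda]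
   through the stationarity condition.  Finally the sufficient decrease, summed
   over the second half of the iterations, forces one step for which
   [(tau1 mu + tau2 lambda) |d|^2 <= 2 mu^2 eps1^2 / M1]. *)
From HB Require Import structures.
Require Import Defs.
From mathcomp Require Import all_boot all_order all_algebra.
From mathcomp Require Import all_classical all_reals all_analysis.
From mathcomp Require Import ring lra.

Import Order.TTheory GRing.Theory Num.Theory.
Import numFieldNormedType.Exports.

Local Open Scope classical_set_scope.
Local Open Scope ring_scope.

(** * Finite-dimensional Hilbert spaces *)

(** The curvature of [gmu] is of order 1/mu, so every estimate has to be rescaled to be uniform
    along the run. The subproblem carries the curvature Lg/mu, and mu * L_mu is nondecreasing in mu,
    so its value at mu_0 serves as a threshold for all iterations. The Lipschitz estimate behind
    that threshold needs a bounded convex set, so a trial point has to be confined before its true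
    feasibility can be judged; satisfying the quadratic model already confines it, and this gives
    the radius [M_R]. The bound [eta_bar] rests on an identity: when the model constraint is active,
    its squared gradient norm at the trial point is the one at the iterate plus 2 (Lg/mu) times the
    slack - g_mu(x). A large gradient or a slack proportional to mu is therefore enough. For small
    mu, Robinson's condition in the quantified form [eta_spec] provides one of the two; before that,
    the slack comes from x0 or from the drop of h_mu as mu decreases. *)

Section Inner.
Context {R : realType} {V : finHilbertType R}.
Implicit Types (x y z : V) (a : R).

Lemma innerDr x y z : inner x (y + z) = inner x y + inner x z.
Proof. by rewrite innerC innerDl !(innerC _ x). Qed.

Lemma innerZr a x y : inner x (a *: y) = a * inner x y.
Proof. by rewrite innerC innerZl innerC. Qed.

Lemma innerNl x y : inner (- x) y = - inner x y.
Proof. by rewrite -scaleN1r innerZl mulN1r. Qed.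

Lemma innerNr x y : inner x (- y) = - inner x y.
Proof. by rewrite innerC innerNl innerC. Qed.

Lemma innerBl x y z : inner (x - y) z = inner x z - inner y z.
Proof. by rewrite innerDl innerNl. Qed.

Lemma innerBr x y z : inner x (y - z) = inner x y - inner x z.
Proof. by rewrite innerDr innerNr. Qed.

Lemma inner0l y : inner 0 y = 0.
Proof. by rewrite -(scale0r 0) innerZl mul0r. Qed.

Lemma inner0r x : inner x 0 = 0.
Proof. by rewrite innerC inner0l. Qed.

Definition innerE := (@innerDl R V, innerDr, innerBl, innerBr, innerNl, innerNr,
  @innerZl R V, innerZr, inner0l, inner0r).

Lemma inner_eq0 x : (forall y, inner x y = 0) -> x = 0.
Proof.
by move=> /(_ x) /eqP; rewrite inner_normE sqrf_eq0 normr_eq0 => /eqP.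
Qed.

Lemma normD_sqr x y : `|x + y| ^+ 2 = `|x| ^+ 2 + 2 * inner x y + `|y| ^+ 2.
Proof. by rewrite -!inner_normE !innerE (innerC y x); ring. Qed.

Lemma cauchy_schwarz x y : inner x y <= `|x| * `|y|.
Proof.
have [->|x0] := eqVneq x 0; first by rewrite inner0l normr0 mul0r.
have [->|y0] := eqVneq y 0; first by rewrite inner0r normr0 mulr0.
have nx : 0 < `|x| by rewrite normr_gt0.
have ny : 0 < `|y| by rewrite normr_gt0.
have : 0 <= `| `|y| *: x + (- `|x|) *: y| ^+ 2 by rewrite sqr_ge0.
rewrite normD_sqr !normrZ !normr_id normrN normr_id !innerE.
move=> h; have : 0 <= (`|x| * `|y|) * (2 * (`|x| * `|y| - inner x y)) by nra.
by rewrite pmulr_rge0 ?mulr_gt0//; lra.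
Qed.

Lemma cauchy_schwarz_norm x y : `|inner x y| <= `|x| * `|y|.
Proof.
by rewrite ler_norml cauchy_schwarz andbT lerNl -innerNl -(normrN x) cauchy_schwarz.
Qed.

Definition innerr y (x : V) : R^o := inner x y.

Lemma innerr_linear y : linear (innerr y).
Proof. by move=> a u v; rewrite /innerr innerDl innerZl. Qed.

HB.instance Definition _ y :=
  GRing.isLinear.Build R V R^o _ (innerr y) (innerr_linear y).

Definition gram (x : V) : 'rV[R]_(\dim {:V}) :=
  \row_i inner x (vbasis {:V})`_i.

Lemma gram_linear : linear gram.
Proof. by move=> a u v; apply/rowP => i; rewrite !mxE innerDl innerZl. Qed.

HB.instance Definition _ :=
  GRing.isLinear.Build R V 'rV[R]_(\dim {:V}) _ gram gram_linear.

(** A vector orthogonal to the whole basis is orthogonal to itself, so [gram] is injective, and by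
    dimension it is onto. A preimage of the values of [l] on the basis represents [l]. This is what
    makes the [get] in [grad] and [adjoint] succeed. *)
Lemma riesz (l : {linear V -> R^o}) : exists w, forall v, l v = inner w v.
Proof.
have e_basis := vbasisP {:V}.
have expand (v : V) : v = \sum_i coord (vbasis {:V}) i v *: (vbasis {:V})`_i.
  by rewrite -coord_vbasis ?memvf.
pose T := linfun gram.
have injT : lker T == 0%VS.
  apply/lker0P => u v; rewrite !lfunE /= => /rowP guv.
  apply/subr0_eq/inner_eq0 => z; rewrite (expand z).
  rewrite innerC -[inner _ _]/(innerr (u - v) _) linear_sum big1 // => i _.
  rewrite linearZ /= /innerr innerC innerBl.
  by have := guv i; rewrite !mxE => ->; rewrite subrr scaler0.
have surjT : limg T = fullv.
  apply/eqP; rewrite eqEdim subvf /= limg_dim_eq ?(eqP injT) ?capv0 //.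
  by rewrite [X in (X <= _)%N]dimvf /dim /= mul1n.
have : (\row_i l (vbasis {:V})`_i : 'rV[R]__) \in limg T by rewrite surjT memvf.
case/memv_imgP => w _ /rowP lw; exists w => v; rewrite (expand v).
rewrite linear_sum innerC -[inner _ _]/(innerr w _) linear_sum.
apply: eq_bigr => i _; rewrite !linearZ /= /innerr innerC; congr (_ *: _).
by have := lw i; rewrite !mxE lfunE /= mxE.
Qed.

End Inner.

(** * Coordinates, compactness and separation *)

Section FiniteDimension.
Context {R : realType} {V : finHilbertType R}.
Implicit Types (x y z : V) (a : R).

Lemma vbasis_expand x :
  x = \sum_i coord (vbasis {:V}) i x *: (vbasis {:V})`_i.
Proof. by rewrite -(coord_vbasis (memvf x)). Qed.

(** Each coordinate is a linear form, hence an inner product, and Cauchy-Schwarz applies.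
    Boundedness of linear maps, compactness and local boundedness of convex functions all go through
    this comparison of coordinates with the norm. *)
Lemma coord_bounded : exists2 c : R, 0 <= c &
  forall i x, `|coord (vbasis {:V}) i x| <= c * `|x|.
Proof.
have /choice[w wE] : forall i, exists w : V,
    forall x, coord (vbasis {:V}) i x = inner w x.
  by move=> i; apply: (riesz (coord (vbasis {:V}) i : {linear V -> R^o})).
exists (\sum_i `|w i|); first by apply: sumr_ge0.
move=> i x; rewrite wE; apply: (le_trans (cauchy_schwarz_norm _ _)).
rewrite ler_wpM2r // (bigD1 i) //= lerDl; exact: sumr_ge0.
Qed.

Lemma linear_bounded (W : normedModType R) (A : {linear V -> W}) :
  exists2 c : R, 0 <= c & forall x, `|A x| <= c * `|x|.
Proof.
have [c c0 cP] := coord_bounded.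
exists (\sum_(i < \dim {:V}) c * `|A (vbasis {:V})`_i|).
  by apply: sumr_ge0 => i _; rewrite mulr_ge0.
move=> x; rewrite {1}(vbasis_expand x) linear_sum.
apply: (le_trans (ler_norm_sum _ _ _)); rewrite mulr_suml; apply: ler_sum => i _.
rewrite linearZ normrZ (le_trans (ler_wpM2r _ (cP i x))) // mulrAC.
exact: lexx.
Qed.

Lemma linear_continuousV (W : normedModType R) (A : {linear V -> W}) :
  continuous A.
Proof.
have [c c0 cP] := linear_bounded W A.
apply: bounded_linear_continuous; apply/linear_boundedP.
by exists c; split; [exact: num_real|move=> r /ltW cr x;
  rewrite (le_trans (cP x)) // ler_wpM2r].
Qed.

(** Heine-Borel is transferred from row vectors: [C] is the continuous image under [S] of a closed
    bounded set of coordinate vectors. *)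
Lemma bounded_closed_compactV (C : set V) (r : R) :
  closed C -> (forall x, C x -> `|x| <= r) -> compact C.
Proof.
move=> Cclosed Cr; have [c c0 cP] := coord_bounded.
pose n := \dim {:V}.
pose S (v : 'rV[R]_n) : V := \sum_i v ord0 i *: (vbasis {:V})`_i.
have contS : continuous S.
  move=> v.
  apply: (@cvg_big V 'I_n +%R 0 xpredT (@add_continuous V) _ (nbhs v)
    (index_enum _) (fun i (u : 'rV[R]_n) => u ord0 i *: (vbasis {:V})`_i)).
  by move=> i _; apply: (@cvgZr_tmp R V _ (nbhs v)); exact: coord_continuous.
pose D := [set v : 'rV[R]_n | `|v| <= c * r] `&` S @^-1` C.
have -> : C = S @` D.
  apply/seteqP; split=> [x Cx|_ [v [_ ?] <-]//].
  exists (\row_i coord (vbasis {:V}) i x); last first.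
    by rewrite {2}(vbasis_expand x); apply: eq_bigr => i _; rewrite mxE.
  split; last first.
    rewrite /= (_ : S _ = x) // {2}(vbasis_expand x).
    by apply: eq_bigr => i _; rewrite mxE.
  have r0 : 0 <= r by rewrite (le_trans _ (Cr x Cx)).
  rewrite /= [leLHS]mx_normrE; apply: bigmax_le => [|[i j] _ /=].
    by rewrite mulr_ge0.
  by rewrite mxE (le_trans (cP _ _)) // ler_wpM2l // Cr.
apply: continuous_compact; first exact: continuous_subspaceT.
apply: bounded_closed_compact.
  exists (c * r); split; first exact: num_real.
  by move=> M /ltW cM v [/= vc _]; exact: le_trans vc cM.
apply: closedI; last exact: closed_comp.
have -> : [set v : 'rV[R]_n | `|v| <= c * r] =
   (fun v : 'rV[R]_n => `|v|) @^-1` [set y | y <= c * r] by [].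
apply: closed_comp => [v _|]; [exact: norm_continuous|exact: closed_le].
Qed.

Lemma conv_comb (C : set V) x y (t : R) : @convex_set R V C -> C x -> C y ->
  0 <= t <= 1 -> C (x + t *: (y - x)).
Proof.
move=> Cconv Cx Cy /andP[t0 t1].
have -> : x + t *: (y - x) = t *: y + (1 - t) *: x.
  by rewrite scalerBr scalerBl scale1r [RHS]addrCA.
exact/set_mem/(Cconv y x (Itv01 t0 t1) (mem_set Cy) (mem_set Cx)).
Qed.

(* [z] is the nearest point of [C] to [y]; the first-order optimality condition
   comes from moving towards [c] by a small step. *)
Lemma separation (C : set V) y : @convex_set R V C -> closed C -> C !=set0 ->
  ~ C y -> exists z, [/\ C z, z != y &
    forall c, C c -> inner (y - z) c <= inner (y - z) z].
Proof.
move=> Cconv Cclosed [c0 Cc0] nCy.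
pose D := C `&` [set c | `|c - y| <= `|c0 - y|].
have distc : continuous (fun c : V => `|c - y| : R).
  move=> c; apply: (@continuous_comp _ _ _ (fun c => c - y) (fun c => `|c| : R)).
    by apply: continuousB; [exact: cvg_id|exact: cvg_cst].
  exact: norm_continuous.
have Dcompact : compact D.
  apply: (@bounded_closed_compactV _ (`|c0 - y| + `|y|)).
    apply: closedI => //.
    apply: (@closed_comp _ _ (fun c : V => `|c - y|) [set u | u <= `|c0 - y|]).
      by move=> c _; exact: distc.
    exact: closed_le.
  move=> c [_ /= cD]; rewrite -[c in leLHS](subrK y).
  by rewrite (le_trans (ler_normD _ _)) // lerD2r.
have [] := @compact_EVT_min V R (fun c => `|c - y|) D _ Dcompact.
- by exists c0; split=> //=.
- exact: continuous_subspaceT.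
move=> z; rewrite inE => -[Cz /= zc0] zmin.
have {}zmin c : C c -> `|z - y| <= `|c - y|.
  move=> Cc; have [cc0|/ltW cc0] := leP `|c - y| `|c0 - y|.
    by apply: zmin; rewrite inE; split.
  exact: le_trans cc0.
exists z; split=> //; first by apply/eqP => zy; rewrite -zy in nCy.
move=> c Cc; rewrite -subr_ge0 -innerBr leNgt; apply/negP => lt0.
set d := c - z; set a := inner (y - z) d.
have a0 : 0 < a by rewrite /a /d -[c - z]opprB innerNr oppr_gt0.
have dpos : 0 < `|d| ^+ 2.
  rewrite exprn_gt0 // normr_gt0; apply/eqP => d0.
  by move: a0; rewrite /a d0 inner0r ltxx.
pose t := Num.min 1 (a / `|d| ^+ 2).
have t0 : 0 < t by rewrite lt_min ltr01 divr_gt0.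
have t1 : t <= 1 by rewrite ge_min lexx.
have ta : t * `|d| ^+ 2 <= a.
  by rewrite -ler_pdivlMr // ge_min lexx orbT.
have := zmin _ (conv_comb _ _ _ t Cconv Cz Cc _); rewrite t1 (ltW t0) => /(_ isT).
rewrite -ler_sqr ?nnegrE // -/d addrAC [leRHS]normD_sqr normrZ exprMn.
rewrite real_normK ?num_real // innerZr -[z - y]opprB innerNl -/a; nra.
Qed.

End FiniteDimension.

(** * Differential calculus *)

Lemma sup_ge {R : realType} (A : set R) (c : R) :
  (exists M, ubound A M) -> A c -> c <= sup A.
Proof. by move=> hM Ac; apply: ub_le_sup. Qed.

(** A set without a supremum is covered as well: there [sup] takes the default value 0. *)
Lemma sup_nneg {R : realType} (A : set R) : (forall a, A a -> 0 <= a) -> 0 <= sup A.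
Proof.
move=> A0; have [[[a Aa] Aub]|nA] := pselect (has_sup A).
  by rewrite (le_trans (A0 a Aa)) // sup_ge.
by rewrite sup_out.
Qed.

Section Operators.
Context {R : realType} {V W : finHilbertType R}.
Implicit Types (x y v : V) (w : W).

Lemma opnorm_ge0 (A : V -> W) : 0 <= opnorm A.
Proof. by apply: sup_nneg => _ [v _ <-]. Qed.

Lemma opnorm_le (E : normedModType R) (A : V -> E) (c : R) : 0 <= c ->
  (forall v, `|A v| <= c * `|v|) -> opnorm A <= c.
Proof.
move=> c0 cP; apply: ge_sup; first by exists `|A 0|, 0 => //=; rewrite normr0.
move=> _ [v /= v1 <-]; apply: (le_trans (cP v)).
by rewrite ler_piMr.
Qed.

(** Phrased for a difference because [smooth] applies [opnorm] to the bare function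
    [fun v => A v - B v]; the two packaged linear maps supply the boundedness that the [sup]
    requires. *)
Lemma le_opnorm (E : normedModType R) (A B : {linear V -> E}) v :
  `|A v - B v| <= opnorm (fun v => A v - B v) * `|v|.
Proof.
have [->|v0] := eqVneq v 0.
  by rewrite normr0 mulr0 (linear0 A) (linear0 B) subr0 normr0.
have nv : 0 < `|v| by rewrite normr_gt0.
have [a a0 aP] := linear_bounded _ A.
have [b b0 bP] := linear_bounded _ B.
rewrite -ler_pdivrMr //; apply: sup_ge.
  exists (a + b) => _ [u /= u1 <-]; apply: (le_trans (ler_normB _ _)).
  by apply: lerD; [apply: (le_trans (aP u))|apply: (le_trans (bP u))];
    rewrite ler_piMr.
exists (`|v|^-1 *: v); first by rewrite /= normrZ normfV normr_id mulVf ?gt_eqF.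
by rewrite (linearZZ A) (linearZZ B) -scalerBr normrZ normfV normr_id mulrC.
Qed.

Lemma le_opnorm1 (E : normedModType R) (A : {linear V -> E}) v :
  `|A v| <= opnorm A * `|v|.
Proof.
have -> : opnorm A = opnorm (fun v => A v - (\0 : V -> E) v).
  by congr opnorm; apply/funext => u; exact: (esym (subr0 (A u))).
by rewrite -(subr0 (A v)); exact: (le_opnorm E A \0 v).
Qed.

Lemma adjointP (A : {linear V -> W}) w v : inner (A v) w = inner v (adjoint A w).
Proof.
have lA : linear (fun v => inner (A v) w : R^o).
  by move=> a x y; rewrite linearP innerDl innerZl.
pose l := GRing.isLinear.Build R V R^o _ _ lA.
have [u uP] := riesz (HB.pack (fun v => inner (A v) w : R^o) l).
rewrite /adjoint; case: xgetP => [u' _|/(_ u)]; first exact.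
by case=> v'; exact: etrans (uP v') (innerC _ _).
Qed.

Lemma adjoint_norm (A : {linear V -> W}) w : `|adjoint A w| <= opnorm A * `|w|.
Proof.
have [->|u0] := eqVneq (adjoint A w) 0.
  by rewrite normr0 mulr_ge0 // opnorm_ge0.
have nu : 0 < `|adjoint A w| by rewrite normr_gt0.
rewrite -(ler_pM2l nu) -expr2 -inner_normE -adjointP.
apply: (le_trans (cauchy_schwarz _ _)); rewrite mulrA ler_wpM2r //.
by rewrite mulrC le_opnorm1.
Qed.

(** With u the difference of the two adjoints, |u|^2 = <(A - B) u, w>; Cauchy-Schwarz and division
    by |u| conclude. *)
Lemma adjointB_norm (A B : {linear V -> W}) w (c : R) :
  opnorm (fun v => A v - B v) <= c -> `|adjoint A w - adjoint B w| <= c * `|w|.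
Proof.
move=> cP; set u := _ - _; have [->|u0] := eqVneq u 0.
  by rewrite normr0 mulr_ge0 // (le_trans _ cP) // opnorm_ge0.
have nu : 0 < `|u| by rewrite normr_gt0.
rewrite -(ler_pM2l nu) -expr2 -inner_normE {2}/u innerBr -!adjointP -innerBl.
apply: (le_trans (cauchy_schwarz _ _)); rewrite mulrA ler_wpM2r //.
by rewrite mulrC (le_trans (le_opnorm _ _ _ _)) // ler_wpM2r.
Qed.

Lemma adjointB (A : {linear V -> W}) w w' :
  adjoint A (w - w') = adjoint A w - adjoint A w'.
Proof.
apply/subr0_eq/inner_eq0 => v.
by rewrite innerC !innerBr -!adjointP innerBr subrr.
Qed.

Lemma adjointZ (A : {linear V -> W}) (a : R) w :
  adjoint A (a *: w) = a *: adjoint A w.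
Proof.
apply/subr0_eq/inner_eq0 => v.
by rewrite innerC !innerBr innerZr -!adjointP innerZr subrr.
Qed.

End Operators.

Section Gradient.
Context {R : realType} {V : finHilbertType R}.
Implicit Types (x y v : V).

Lemma gradP (F : V -> R) x v : 'd F x v = inner (grad F x) v.
Proof.
have [u uP] := riesz ('d F x).
by rewrite /grad; case: xgetP => [u' _|/(_ u)]; [exact|case=> v'].
Qed.

Lemma grad_unique (F : V -> R) x u :
  (forall v, 'd F x v = inner u v) -> grad F x = u.
Proof.
by move=> uP; apply/subr0_eq/inner_eq0 => v; rewrite innerBl -gradP uP subrr.
Qed.

Lemma line_is_derive (W : normedModType R) (F : V -> W) x d (t : R) :
  differentiable F (x + t *: d) ->
  is_derive t 1 (fun t : R => F (x + t *: d)) ('d F (x + t *: d) d).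
Proof.
move=> dF.
have dl : is_diff t (fun t : R => x + t *: d) (fun t : R => t *: d).
  by apply: is_diff_eq; rewrite add0r.
have dF' : is_diff (x + t *: d) F ('d F (x + t *: d)) by exact: DiffDef.
have [dc dcE] := is_diff_comp dl dF'.
apply: DeriveDef; first by apply/derivable1_diffP.
by rewrite deriveE // dcE /= scale1r.
Qed.

End Gradient.

Section Calculus.
Context {R : realType} {V : finHilbertType R}.
Implicit Types (x y v d : V).

(** The limit t -> 0 without topology: if b < a, the chosen [t] makes t c at most half the gap. *)
Lemma le_add_small (a b c : R) : (forall t, 0 < t <= 1 -> a <= b + t * c) -> a <= b.
Proof.
move=> h; rewrite leNgt; apply/negP => ba.
have c0 : 0 < c by have := h 1; rewrite ltr01 lexx => /(_ isT); lra.
pose t := Num.min 1 ((a - b) / (2 * c)).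
have t0 : 0 < t by rewrite lt_min ltr01 divr_gt0 // ?mulr_gt0 // subr_gt0.
have t1 : t <= 1 by rewrite ge_min lexx.
have tc : t * (2 * c) <= a - b.
  by rewrite -ler_pdivlMr ?mulr_gt0 // ge_min lexx orbT.
by have := h t; rewrite t0 t1 => /(_ isT); lra.
Qed.

(** The mean value theorem is applied to F (x + t d) minus a t + k t^2 / 2, whose derivative is
    nonpositive on [0, 1]; this replaces an integration. A zero [k] gives the mean value bound, and
    [a] = 'd F x d the descent lemma. *)
Lemma line_mvt (F : V -> R) x d (a k : R) : (forall y, differentiable F y) ->
  (forall t, 0 <= t <= 1 -> 'd F (x + t *: d) d <= a + k * t) ->
  F (x + d) - F x <= a + k / 2.
Proof.
move=> dF dle.
pose phi t : R := F (x + t *: d) - (a * t + k / 2 * t ^+ 2).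
pose dphi t : R := 'd F (x + t *: d) d - (a + k * t).
have dphiP t : is_derive t (1 : R) phi (dphi t).
  have := line_is_derive _ F x d t (dF _) => dl.
  apply: is_deriveB.
  pose m (t : R) := a *: t + (k / 2) *: t ^+ 2.
  have -> : (fun t : R => a * t + k / 2 * t ^+ 2) = m by [].
  by apply: is_derive_eq; rewrite /= /GRing.scale /=; field.
have cphi : {within `[(0:R), 1], continuous phi}.
  apply: continuous_subspaceT => t.
  by apply/differentiable_continuous/derivable1_diffP.
have [c] := MVT ltr01 (fun t _ => dphiP t) cphi.
rewrite in_itv /= => /andP[c0 c1].
rewrite /phi /dphi scale0r addr0 scale1r => E.
by have := dle c; rewrite (ltW c0) (ltW c1) => /(_ isT); lra.
Qed.

Lemma descent_lemma (F : V -> R) x d (L : R) : (forall y, differentiable F y) ->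
  (forall t, 0 <= t <= 1 ->
     'd F (x + t *: d) d - 'd F x d <= L * t * `|d| ^+ 2) ->
  F (x + d) <= F x + 'd F x d + L / 2 * `|d| ^+ 2.
Proof.
move=> dF dle; have := @line_mvt F x d ('d F x d) (L * `|d| ^+ 2) dF.
have h t : 0 <= t <= 1 -> 'd F (x + t *: d) d <= 'd F x d + L * `|d| ^+ 2 * t.
  by move=> /dle; lra.
by move=> /(_ h); lra.
Qed.

Lemma diff_inner (U : finHilbertType R) (F : V -> U) (w : U) x :
  differentiable F x ->
  is_diff x (fun y => inner (F y) w) (fun v => inner ('d F x v) w).
Proof.
move=> dF; have c : continuous (innerr w) by apply: linear_continuousV.
have dFx : is_diff x F ('d F x) by exact: DiffDef.
have dw : is_diff (F x) (innerr w) (innerr w).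
  by apply: DiffDef; [exact: linear_differentiable|rewrite diff_lin].
exact: (is_diff_comp dFx dw).
Qed.

(** The scalar case is applied to the pairing of [F] with its own increment [w], and the result is
    divided by |w|. *)
Lemma mean_value_le (U : finHilbertType R) (F : V -> U) x d (M : R) :
  (forall y, differentiable F y) ->
  (forall t, 0 <= t <= 1 -> `|'d F (x + t *: d) d| <= M) ->
  `|F (x + d) - F x| <= M.
Proof.
move=> dF dle; set w := _ - _.
have [->|w0] := eqVneq w 0.
  by rewrite normr0 (le_trans _ (dle 0 _)) // lexx ler01.
have nw : 0 < `|w| by rewrite normr_gt0.
have dFw y := diff_inner U F w y (dF y).
have := @line_mvt (fun y => inner (F y) w) x d (M * `|w|) 0.
rewrite -innerBl -/w inner_normE mul0r addr0 expr2 ler_pM2r //; apply.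
  by move=> y; have [] := dFw y.
move=> t /dle tM; have [_ ->] := dFw (x + t *: d); rewrite mul0r addr0.
by rewrite (le_trans (cauchy_schwarz _ _)) // ler_wpM2r.
Qed.

Lemma convex_functionE (P : V -> R) x y (t : R) :
  @convex_function R V setT P -> 0 <= t <= 1 ->
  P (x + t *: (y - x)) <= P x + t * (P y - P x).
Proof.
move=> cP /andP[t0 t1].
have -> : x + t *: (y - x) = t *: y + (1 - t) *: x.
  by rewrite scalerBr scalerBl scale1r [RHS]addrCA.
have := cP (Itv01 t0 t1) y x (mem_setT _) (mem_setT _).
move=> /le_trans; apply; rewrite convRE /=.
have -> : t * P y + (1 - t) * P x = P x + t * (P y - P x) by ring.
exact: lexx.
Qed.

Lemma convex_diff_le (P : V -> R) x y : @convex_function R V setT P ->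
  differentiable P x -> P x + 'd P x (y - x) <= P y.
Proof.
move=> cP dP; set d := y - x; rewrite addrC -lerBrDr.
have dx : derivable P x d by exact: diff_derivable.
have := @cvg_dnbhs_at_right _ _ _ _ _ dx.
rewrite -deriveE //; move=> /cvgr_to_le; apply.
near=> t; rewrite /= /GRing.scale /=.
have t0 : 0 < t by near: t; exact: nbhs_right_gt.
have t1 : t <= 1 by near: t; apply: nbhs_right_le.
rewrite ler_pdivrMl // lerBlDl [t *: d + x]addrC.
by apply: convex_functionE => //; rewrite (ltW t0) t1.
Unshelve. all: by end_near. Qed.

Lemma grad_quadratic (F : V -> R) x u (c : R) :
  (forall v, F (x + v) = F x + inner u v + c * `|v| ^+ 2) -> grad F x = u.
Proof.
move=> FE; have cu : continuous (innerr u) by apply: linear_continuousV.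
apply: grad_unique => v; rewrite innerC -/(innerr u v); congr (_ v).
apply: diff_unique => //; apply/eqaddoP => e e0.
near=> h; rewrite !fctE /= [h + x]addrC FE /cst /innerr (innerC h).
rewrite (_ : _ - _ = c * `|h| ^+ 2); last by ring.
rewrite normrM expr2 normrM normr_id mulrA ler_wpM2r //.
suff : `|c| * `|h| <= (`|c| + 1) * (e / (`|c| + 1)).
  by rewrite mulrCA mulfV ?mulr1 // gt_eqF // ltr_wpDl.
apply: ler_pM => //; first by rewrite lerDl.
near: h; apply: nbhs0_le.
by rewrite divr_gt0 // ltr_wpDl.
Unshelve. all: by end_near. Qed.

End Calculus.

(** * Convex functions, support functions and polarity *)

Section Convexity.
Context {R : realType} {V : finHilbertType R}.
Implicit Types (x y z v d : V) (P : V -> R).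

Lemma convex_midpoint P x y : @convex_function R V setT P ->
  P (2^-1 *: (x + y)) <= (P x + P y) / 2.
Proof.
move=> cP; have -> : 2^-1 *: (x + y) = x + 2^-1 *: (y - x).
  rewrite scalerDr scalerBr [RHS]addrCA addrC; congr (_ + _).
  by rewrite -{2}[x]scale1r -scalerBl; congr (_ *: _); lra.
by rewrite (le_trans (convex_functionE _ x y 2^-1 cP _)) //; lra.
Qed.

(** Induction on the vectors: the sum is the midpoint of twice its head and twice its tail, so the
    tail is bounded with coefficients up to 2c. The head lies on the segment from -2c e to 2c e,
    where convexity bounds [P] by its values at the ends. *)
Lemma convex_bounded_above P (s : seq V) (c : R) : @convex_function R V setT P ->
  exists M, forall a : nat -> R, (forall i, `|a i| <= c) ->
    P (\sum_(i < size s) a i *: s`_i) <= M.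
Proof.
move=> cP; elim: s c => [|e s IH] c.
  by exists (P 0) => a _; rewrite big_ord0.
have [M MP] := IH (2 * c).
pose m := Num.max (P ((- (2 * c)) *: e)) (P ((2 * c) *: e)).
exists ((m + M) / 2) => a ac; rewrite big_ord_recl /=.
have -> : a 0 *: e + \sum_(i < size s) a (bump 0 i) *: s`_i =
   2^-1 *: ((2 * a 0) *: e + \sum_(i < size s) (2 * a i.+1) *: s`_i).
  rewrite scalerDr scalerA mulKf ?pnatr_eq0 // scaler_sumr; congr (_ + _).
  by apply: eq_bigr => i _; rewrite scalerA mulKf ?pnatr_eq0.
apply: (le_trans (convex_midpoint _ _ _ cP)).
rewrite ler_wpM2r // lerD //; last first.
  by apply: (MP (fun i => 2 * a i.+1)) => i; rewrite normrM ger0_norm // ler_wpM2l.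
have := ac 0%N; rewrite ler_norml => /andP[a1 a2].
have [c0|c0] := eqVneq c 0.
  by move: a1 a2; rewrite /m c0 oppr0 => a1 a2;
    have -> : a 0 = 0 by [lra]; rewrite mulr0 oppr0 maxxx.
have cpos : 0 < c by rewrite lt_neqAle eq_sym c0 (le_trans _ (ac 0)).
pose t := (a 0%N + c) / (2 * c).
have t01 : 0 <= t <= 1.
  by rewrite /t divr_ge0 ?ler_pdivrMr ?mulr_gt0 //=; lra.
have -> : (2 * a 0%N) *: e =
    (- (2 * c)) *: e + t *: ((2 * c) *: e - (- (2 * c)) *: e).
  by rewrite -scalerBl scalerA -scalerDl /t; congr (_ *: _); field.
apply: (le_trans (convex_functionE _ _ _ _ cP t01)).
move: t01 => /andP[t0 t1].
have m1 : P ((- (2 * c)) *: e) <= m by rewrite le_max lexx.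
have m2 : P ((2 * c) *: e) <= m by rewrite le_max lexx orbT.
set A := P _ in m1 *; set B := P _ in m2 *; nra.
Qed.

(** The bound below follows from the bound above at - x, since 0 is the midpoint of x and - x. *)
Lemma convex_bounded P (r : R) : @convex_function R V setT P ->
  exists M, forall x, `|x| <= r -> `|P x| <= M.
Proof.
move=> cP; have [c c0 cB] := @coord_bounded R V.
have [M MP] := convex_bounded_above P (vbasis {:V}) (c * r) cP.
have ub x : `|x| <= r -> P x <= M.
  move=> xr; have r0 : 0 <= r by rewrite (le_trans _ xr).
  (* The coordinates of x are extended by 0 to all natural numbers, the form of coefficients
     expected by [convex_bounded_above]. *)
  pose a i := if insub i is Some j then coord (vbasis {:V}) j x else 0.
  have := MP a; rewrite size_tuple.
  have -> : \sum_(i < \dim {:V}) a i *: (vbasis {:V})`_i = x.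
    rewrite [RHS](vbasis_expand x); apply: eq_bigr => i _.
    by rewrite /a valK.
  apply => i; rewrite /a; case: insubP => [j _ _|_].
    by rewrite (le_trans (cB _ _)) // ler_wpM2l.
  by rewrite normr0 mulr_ge0.
exists (Num.max M (M - 2 * P 0)) => x xr; rewrite ler_norml; apply/andP; split.
  have := convex_midpoint P x (- x) cP; rewrite subrr scaler0.
  have := ub (- x); rewrite normrN => /(_ xr).
  have : M - 2 * P 0 <= Num.max M (M - 2 * P 0) by rewrite le_max lexx orbT.
  lra.
by rewrite le_max ub.
Qed.

(** The subgradient inequality is tested one unit away from x in the direction of [zeta], which is
    why [P] is bounded on the radius r + 1: |zeta| is at most the increment of [P]. *)
Lemma subdiff_bounded P (r : R) : @convex_function R V setT P ->
  exists2 M, 0 <= M & forall x zeta, `|x| <= r -> subdiff P x zeta -> `|zeta| <= M.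
Proof.
move=> cP; have [M MP] := convex_bounded P (r + 1) cP.
exists (2 * `|M|); first by rewrite mulr_ge0.
move=> x zeta xr sub; have [->|z0] := eqVneq zeta 0.
  by rewrite normr0 mulr_ge0.
have nz : `|zeta| != 0 by rewrite normr_eq0.
have [t tE] : exists t : R, t = `|zeta|^-1 by exists `|zeta|^-1.
have := sub (x + t *: zeta).
rewrite [X in inner zeta X]addrC addKr innerZr inner_normE expr2 tE mulKf // -tE.
have h1 : `|P (x + t *: zeta)| <= M.
  apply: MP; rewrite (le_trans (ler_normD _ _)) // lerD //.
  by rewrite normrZ tE normfV normr_id mulVf.
have h2 : `|P x| <= M by rewrite MP // (le_trans xr) // lerDl.
move: h1 h2; rewrite !ler_norml => /andP[_ h1] /andP[h2 _].
by have := ler_norm M; lra.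
Qed.

(* Both sides of the subgradient inequality are compared at [x + t d], where the
   quadratic contributes only [O(t^2)]; convexity of [P] allows to divide by [t]. *)
Lemma subdiff_quadratic P a xk (c : R) x zeta : @convex_function R V setT P ->
  subdiff (fun y => P y + inner a (y - xk) + c / 2 * `|y - xk| ^+ 2) x zeta ->
  subdiff P x (zeta - a - c *: (x - xk)).
Proof.
move=> cP sub y; set d := y - x.
suff : inner (zeta - a - c *: (x - xk)) d <= P y - P x by lra.
apply: (@le_add_small _ _ _ (c / 2 * `|d| ^+ 2)) => t /andP[t0 t1].
have /= := sub (x + t *: d).
rewrite [X in inner zeta X]addrC addKr innerZr.
have -> : x + t *: d - xk = (x - xk) + t *: d by rewrite addrAC.
rewrite (normD_sqr (x - xk)) (innerDr a (x - xk)) !innerZr normrZ exprMn.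
rewrite real_normK ?num_real //.
have := convex_functionE P x y t cP; rewrite (ltW t0) t1 => /(_ isT).
rewrite -/d !innerBl innerZl => h1 h2; rewrite -(ler_pM2l t0) innerBl; lra.
Qed.

End Convexity.

(** * Support functions of compact sets, and membership by duality *)

Section Support.
Context {R : realType} {V : finHilbertType R}.
Variables (B : set V).
Hypothesis B_compact : compact B.

Lemma compact_norm_bounded : exists M, forall u, B u -> `|u| <= M.
Proof.
have [M [_ MP]] := compact_bounded B_compact.
by exists (M + 1) => u Bu; apply: (MP (M + 1)) => //; rewrite ltrDl.
Qed.

Lemma le_support_fun y u : B u -> inner y u <= support_fun B y.
Proof.
move=> Bu; have [M MP] := compact_norm_bounded.
apply: sup_ge; last by exists u.
exists (`|y| * M) => _ [w Bw <-].
by rewrite (le_trans (cauchy_schwarz _ _)) // ler_wpM2l // MP.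
Qed.

Lemma support_fun_le y (c : R) : B !=set0 -> (forall u, B u -> inner y u <= c) ->
  support_fun B y <= c.
Proof.
move=> [u Bu] cP; apply: ge_sup; first by exists (inner y u), u.
by move=> _ [w Bw <-]; exact: cP.
Qed.

Lemma M_B_ge u : B u -> `|u| <= M_B B.
Proof.
move=> Bu; have [M MP] := compact_norm_bounded.
by apply: sup_ge; [exists M => _ [w Bw <-]; exact: MP|exists u].
Qed.

Lemma M_B_ge0 : 0 <= M_B B.
Proof. by apply: sup_nneg => _ [u _ <-]. Qed.

Lemma support_funZ y (t : R) : B !=set0 -> 0 < t ->
  support_fun B (t *: y) <= t * support_fun B y.
Proof.
move=> B0 t0; apply: support_fun_le => // u Bu.
by rewrite innerZl ler_pM2l // le_support_fun.
Qed.

(* A vector dominated by the support function of a compact convex set up to an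
   additive constant lies in the set: the constant disappears by scaling. *)
Lemma support_fun_mem w (c : R) : B !=set0 -> @convex_set R V B ->
  (forall z, inner w z <= support_fun B z + c) -> B w.
Proof.
move=> B0 Bconv wP.
have wP' z : inner w z <= support_fun B z.
  apply: (@le_add_small _ _ _ c) => t /andP[t0 _].
  have := wP (t^-1 *: z); rewrite innerZr => h.
  have := le_trans h (lerD (support_funZ z t^-1 B0 _) (lexx c)).
  by rewrite invr_gt0 => /(_ t0); rewrite -(ler_pM2l t0) mulrDr !mulVKf ?gt_eqF.
apply: contrapT => nBw.
have [z [Bz zw zP]] := separation B w Bconv
  (compact_closed (@norm_hausdorff _ _) B_compact) B0 nBw.
have := wP' (w - z); rewrite innerC => /le_trans /(_ (support_fun_le _ _ B0 zP)).
rewrite -subr_le0 -innerBr inner_normE real_exprn_even_le0 ?num_real //=.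
by rewrite normr_eq0 subr_eq0 eq_sym (negPf zw).
Qed.

End Support.

(** Let z be the projection of y on the cone. Testing optimality at 0 and 2 z gives <y - z, z> = 0,
    so y - z lies in the polar and is a nonnegative multiple of an element of [B]. Then |y - z|^2 =
    <y, y - z> <= 0. This turns [gm m x <= 0] into feasibility. *)
Lemma bipolar {R : realType} {V : finHilbertType R} (K B : set V) y :
  is_cone K -> closed K -> @convex_set R V K -> K !=set0 ->
  is_base (polar K) B -> (forall u, B u -> inner y u <= 0) -> K y.
Proof.
move=> Kcone Kclosed Kconv [k0 Kk0] [_ _ polE] yP; apply: contrapT => nKy.
have [z [Kz zy zP]] := separation K y Kconv Kclosed (ex_intro _ _ Kk0) nKy.
have K0 : K 0 by rewrite -(scale0r k0); exact: Kcone.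
have z0 : inner (y - z) z = 0.
  have := zP 0 K0; rewrite inner0r.
  have := zP (2 *: z) (Kcone 2 z _ Kz); rewrite innerZr => /(_ (ler0n _ _)) h1 h2; lra.
have pol : polar K (y - z) by move=> w /zP; rewrite z0.
move: (pol); rewrite polE => -[t /= t0 [u Bu tu]].
have : inner y (y - z) - inner z (y - z) <= 0.
  by rewrite (innerC z) z0 subr0 -tu innerZr mulr_ge0_le0 // yP.
rewrite -innerBl inner_normE.
rewrite real_exprn_even_le0 ?num_real //= normr_eq0 subr_eq0.
by rewrite eq_sym (negPf zy).
Qed.

(** * Descent and Lipschitz estimates for smooth maps *)

Section SmoothMaps.
Context {R : realType} {V : finHilbertType R}.
Implicit Types (x y v d : V).

Lemma smooth_diff_le (W : normedModType R) (L : R) (F : V -> W) x y v :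
  smooth L F -> `|'d F x v - 'd F y v| <= L * `|x - y| * `|v|.
Proof.
by move=> [_ hF]; rewrite (le_trans (le_opnorm _ _ _ _)) // ler_wpM2r.
Qed.

Lemma smooth_opnorm_le (W : normedModType R) (L : R) (F : V -> W) x : 0 <= L ->
  smooth L F -> opnorm ('d F x) <= opnorm ('d F 0) + L * `|x|.
Proof.
move=> L0 hF; apply: opnorm_le => [|v].
  by rewrite addr_ge0 ?mulr_ge0 //; apply: sup_nneg => _ [? _ <-].
have := smooth_diff_le W L F x 0 v hF; rewrite subr0 => h.
rewrite mulrDl -['d F x v](subrK ('d F 0 v)) addrC.
by rewrite (le_trans (ler_normD _ _)) // lerD // le_opnorm1.
Qed.

Lemma smooth_grad_lipschitz (L : R) (F : V -> R) x y : smooth L F ->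
  `|grad F x - grad F y| <= L * `|x - y|.
Proof.
move=> hF; set u := _ - _; have [u0|u0] := eqVneq u 0.
  rewrite u0 normr0; apply: le_trans (hF.2 x y).
  by apply: sup_nneg => _ [? _ <-].
have nu : 0 < `|u| by rewrite normr_gt0.
rewrite -(ler_pM2r nu) -expr2 -inner_normE {1}/u innerBl -!gradP.
exact: le_trans (ler_norm _) (smooth_diff_le _ _ _ _ _ _ hF).
Qed.

Lemma smooth_descent (L : R) (F : V -> R) x d : smooth L F ->
  F (x + d) <= F x + inner (grad F x) d + L / 2 * `|d| ^+ 2.
Proof.
move=> hF; rewrite -gradP; apply: descent_lemma; first by case: hF => -[].
move=> t /andP[t0 _]; apply: (le_trans (ler_norm _)).
apply: (le_trans (smooth_diff_le _ _ _ _ _ _ hF)).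
by rewrite [x + _]addrC addrK normrZ (ger0_norm t0) expr2 !mulrA.
Qed.

Lemma smooth_inner_descent (W : finHilbertType R) (L : R) (G : V -> W) x d w :
  smooth L G ->
  inner w (G (x + d)) <=
    inner w (G x) + inner w ('d G x d) + `|w| * L / 2 * `|d| ^+ 2.
Proof.
move=> hG; have dG y : differentiable G y by case: hG => -[].
have dI y := diff_inner _ G w y (dG y).
have := @descent_lemma R V (fun y => inner (G y) w) x d (`|w| * L).
have [_ ->] := dI x; rewrite !(innerC w); apply.
  by move=> y; have [] := dI y.
move=> t /andP[t0 _]; have [_ ->] := dI (x + t *: d).
rewrite -innerBl (le_trans (cauchy_schwarz _ _)) // mulrC -!mulrA ler_wpM2l //.
apply: (le_trans (smooth_diff_le _ _ _ _ _ _ hG)).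
by rewrite [x + _]addrC addrK normrZ (ger0_norm t0) expr2 !mulrA.
Qed.

End SmoothMaps.

Section ConvexHull.
Context {R : realType} {V : finHilbertType R}.

Lemma convex_hull_convex (A : set V) : @convex_set R V (convex_hull A).
Proof.
move=> x y t /set_mem hx /set_mem hy; apply: mem_set => C [Cconv AC].
by apply/set_mem/Cconv; apply: mem_set; [exact: hx|exact: hy].
Qed.

Lemma convex_hull_sub (A : set V) : A `<=` convex_hull A.
Proof. exact: sub_smallest. Qed.

Lemma convex_hull_bounded (A : set V) (r : R) : (forall x, A x -> `|x| <= r) ->
  forall x, convex_hull A x -> `|x| <= r.
Proof.
move=> Ar x hx; apply: (hx [set z | `|z| <= r]); split=> //.
move=> y z t /set_mem /= yr /set_mem /= zr.
apply: mem_set => /=; have [t0 t1] : 0 <= t%:num /\ t%:num <= 1 by split.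
rewrite (le_trans (ler_normD _ _)) // !normrZ ger0_norm //.
by rewrite ger0_norm ?subr_ge0 // /unstable.onem; nra.
Qed.

End ConvexHull.

Lemma subr2K {V : zmodType} (z a b : V) : z - a - b + a + b = z.
Proof. by rewrite addrAC subrK subrK. Qed.

(** * Arithmetic of the estimates *)

Lemma edist0_le {R : realType} {V : normedModType R} (u : V) (e : R) :
  `|u| <= e -> (edist (0%R : V, u) <= e%:E)%E.
Proof.
move=> ue; apply/lee_addgt0Pr => r r0; apply: edist_fin.
  by rewrite ltr_wpDl // (le_trans _ ue).
by rewrite -ball_normE /= sub0r normrN (le_lt_trans ue) // ltrDl.
Qed.

Section Stationarity.
Context {R : realType} {V : finHilbertType R}.
Implicit Types (x y z a b d v : V) (k l r : R).

(** Pairing with an arbitrary vector moves a vector identity to the reals, where [lra] finishes;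
    [inner_eq0] leads back to vectors. *)
Lemma inner_stationarity z a x d b k l r v :
  z + (a - x) + k *: d + l *: (b + r *: d) = 0 ->
  inner z v + inner a v - inner x v + k * inner d v
    + l * (inner b v + r * inner d v) = 0.
Proof. by move=> /(congr1 (inner^~ v)); rewrite !innerE => <-; ring. Qed.

Lemma stationarity_shift z a x d b k l r a' b' :
  z + (a - x) + k *: d + l *: (b + r *: d) = 0 ->
  z - x + a' + l *: b' = (a' - a) - (k + l * r) *: d + l *: (b' - b).
Proof.
move=> eq0; apply/subr0_eq/inner_eq0 => v.
have := inner_stationarity z a x d b k l r v eq0.
by rewrite !innerE => h; lra.
Qed.

Lemma norm_linear_sqr b d r :
  `|b + r *: d| ^+ 2 = `|b| ^+ 2 + 2 * r * inner b d + r ^+ 2 * `|d| ^+ 2.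
Proof.
by rewrite normD_sqr innerZr normrZ exprMn real_normK ?num_real // mulrA.
Qed.

(* The left-hand side is [|b / 2 + r d|^2 - |b|^2 / 4]. *)
Lemma inner_linear_ge b d r : - (`|b| ^+ 2 / 4) <= r * inner d (b + r *: d).
Proof.
have := sqr_ge0 `|2^-1 *: b + r *: d|; rewrite norm_linear_sqr innerZl normrZ.
rewrite exprMn ger0_norm // innerDr innerZr inner_normE (innerC b); lra.
Qed.

End Stationarity.

(** After division by N^2 the right-hand side decreases in N, so N may be replaced by its lower
    bound [e]. *)
Lemma multiplier_arith (R : realFieldType) (N e lam S T : R) :
  0 < e -> e <= N -> 0 <= S -> 0 <= T -> lam * N ^+ 2 <= S * N + T ->
  lam <= S / e + T / e ^+ 2.
Proof.
move=> e0 eN S0 T0 h; have N0 : 0 < N := lt_le_trans e0 eN.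
apply: (@le_trans _ _ (S / N + T / N ^+ 2)).
  have -> : S / N + T / N ^+ 2 = (S * N + T) / N ^+ 2 by field; rewrite gt_eqF.
  by rewrite ler_pdivlMr // exprn_gt0.
rewrite lerD // ler_wpM2l // lef_pV2 ?posrE ?exprn_gt0 //.
by rewrite lerXn2r ?nnegrE // ltW.
Qed.

Lemma active_arith (R : realFieldType) (b2 g bd r D : R) :
  g + bd + r / 2 * D = 0 ->
  b2 + 2 * r * bd + r ^+ 2 * D = b2 - 2 * r * g.
Proof. by move=> act; have -> : bd = - g - r / 2 * D by [lra]; field. Qed.

Lemma residual_arith (R : realFieldType) (u v w l lam k r LG MB D : R) :
  v <= l * D -> lam * w <= lam * (LG * D * MB) -> u <= v + (k + lam * r) * D ->
  u + lam * w <= (l + k + lam * LG * MB + lam * r) * D.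
Proof. lra. Qed.

Lemma complementarity_arith (R : realFieldType) (wt wk bd h W M LG r a D lam : R) :
  0 <= lam -> - wt <= - wk + - bd + W * LG / 2 * D ->
  W * LG / 2 * D <= M * LG / 2 * D -> h <= a + wk ->
  lam * (h + bd + r * D) = 0 ->
  lam * - wt <= lam * (a + (r + LG * M / 2) * D).
Proof.
move=> lam0 h1 h2 h3 h4.
have h5 : - wt <= a - h - bd + M * LG / 2 * D by lra.
by have := ler_wpM2l lam0 h5; lra.
Qed.

(** Multiplying by m cancels the 1/m of the constraint curvature. Of the four terms, two are then at
    most M m and two at most M lam. *)
Lemma scaled_residual_le (R : realFieldType) (m m0 lam l k g LG MB M : R) :
  0 < m -> m <= m0 -> 0 <= lam -> l <= M -> k <= M -> g <= M ->
  m0 * (LG * MB) <= M -> 0 <= LG * MB ->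
  (l + k + lam * LG * MB + lam * (g / m)) * m <= 2 * M * (m + lam).
Proof.
move=> m_gt0 mm lam0 lM kM gM cM c0.
have -> : (l + k + lam * LG * MB + lam * (g / m)) * m =
  l * m + k * m + lam * (m * (LG * MB)) + lam * g by field; rewrite gt_eqF.
have h1 := ler_wpM2r (ltW m_gt0) lM; have h2 := ler_wpM2r (ltW m_gt0) kM.
have h3 := ler_wpM2l lam0 gM.
have h4 := ler_wpM2l lam0 (le_trans (ler_wpM2r c0 mm) cM).
lra.
Qed.

Lemma pairing_arith (R : realFieldType)
    (zv av xv bv dv Mz Ma Mx N lam L1 r t : R) :
  zv + av - xv + L1 * dv + lam * (bv + r * dv) = 0 ->
  bv + r * dv = N ^+ 2 ->
  - zv <= Mz * N -> - av <= Ma * N -> xv <= Mx * N ->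
  - (L1 * dv) <= t ->
  lam * N ^+ 2 <= (Ma + Mz + Mx) * N + t.
Proof. by move=> h <-; lra. Qed.

Lemma descent_arith (R : realFieldType)
    (fx fk P1x P1k P2x P2k zd fd xd bd g lam l L1 r r' D c : R) :
  P1x + - zd <= P1k ->
  zd + fd - xd + L1 * D + lam * (bd + r * D) = 0 ->
  fx <= fk + fd + l / 2 * D ->
  P2k + xd <= P2x ->
  lam * (g + bd + r' * D) = 0 ->
  lam * g <= 0 ->
  lam * r * D = 2 * (lam * (r' * D)) ->
  c <= (L1 - l) / 2 * D + lam * (r' * D) ->
  0 <= L1 * D ->
  fx + P1x - P2x <= fk + P1k - P2k - c.
Proof. lra. Qed.

Lemma sum_nat_exists_le (R : realDomainType) (a c : nat -> R) (m n : nat) :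
  (m < n)%N -> \sum_(m <= k < n) a k <= \sum_(m <= k < n) c k ->
  exists2 k, (m <= k < n)%N & a k <= c k.
Proof.
move=> mn; apply: contraPP => h; apply/negP; rewrite -ltNge.
apply: ltr_sum_nat => // k mkn; rewrite ltNge; apply/negP => ack.
by apply: h; exists k.
Qed.

(** * The three tolerances from one step of small decrease *)

Section KKTArithmetic.
Context {R : rcfType}.
(** In the application [m] is mu_k, [m0] is mu_0, [M] is [M_L], [l] is [M_lambda], [Z] is the
    maximum inside [M1_bar], and [D] is the length of the step. *)
Variables (m m0 t1 t2 M l Z M1 e1 e2 lam D : R).
Hypotheses (m_gt0 : 0 < m) (m_le : m <= m0) (t1_gt0 : 0 < t1) (t2_gt0 : 0 < t2).
Hypotheses (M_gt0 : 0 < M) (Z_gt0 : 0 < Z) (M1E : M1 = 16 * M ^+ 2 * Z).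
Hypotheses (e1_gt0 : 0 < e1) (e2_gt0 : 0 < e2).
Hypotheses (lam_ge0 : 0 <= lam) (lam_le : lam <= l) (D_ge0 : 0 <= D).
Hypothesis decrease :
  (t1 * m + t2 * lam) / (2 * m) * D ^+ 2 <= m * (e1 ^+ 2 / M1).

Lemma M1_gt0 : 0 < M1.
Proof. by rewrite M1E !mulr_gt0 // exprn_gt0. Qed.

Lemma scaled_decrease :
  (t1 * m + t2 * lam) * D ^+ 2 * M1 <= 2 * m ^+ 2 * e1 ^+ 2.
Proof.
have M1p := M1_gt0.
have c : 0 < 2 * m * M1 by rewrite !mulr_gt0.
have := decrease; rewrite -(ler_pM2l c).
have -> : 2 * m * M1 * ((t1 * m + t2 * lam) / (2 * m) * D ^+ 2) =
  (t1 * m + t2 * lam) * D ^+ 2 * M1 by field; rewrite gt_eqF.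
by have -> : 2 * m * M1 * (m * (e1 ^+ 2 / M1)) = 2 * m ^+ 2 * e1 ^+ 2
  by field; rewrite gt_eqF.
Qed.

(** Origin of the 16 in [M1_bar]: squaring 2 M gives 4, (m + lam)^2 <= 2 (m^2 + lam^2) gives 2, and
    the 2 m below the decrease gives 2. The factor [Z] converts m^2 + lam^2 into t1 m + t2 lam. *)
Lemma residual_le_eps1 (rho : R) : m0 / t1 <= Z -> l / t2 <= Z ->
  0 <= rho -> rho * m <= 2 * M * (m + lam) -> rho * D <= e1.
Proof.
move=> Z1 Z2 rho0 hrho.
have sq : (m + lam) ^+ 2 <= 2 * (Z * (t1 * m + t2 * lam)).
  have h1 : m <= Z * t1.
    by rewrite -ler_pdivrMr // (le_trans _ Z1) // ler_wpM2r // invr_ge0 ltW.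
  have h2 : lam <= Z * t2.
    by rewrite -ler_pdivrMr // (le_trans _ Z2) // ler_wpM2r // invr_ge0 ltW.
  have := sqr_ge0 (m - lam); have := ler_wpM2r (ltW m_gt0) h1.
  have := ler_wpM2r lam_ge0 h2; lra.
have dec := scaled_decrease.
have h : (rho * m) ^+ 2 * D ^+ 2 <= m ^+ 2 * e1 ^+ 2.
  apply: (@le_trans _ _ ((2 * M * (m + lam)) ^+ 2 * D ^+ 2)).
    rewrite ler_wpM2r ?sqr_ge0 // lerXn2r ?nnegrE ?(le_trans _ hrho) //;
    by rewrite mulr_ge0 // ltW.
  have := ler_wpM2l (mulr_ge0 (sqr_ge0 M) (sqr_ge0 D)) sq.
  move: dec; rewrite M1E; lra.
rewrite -(ler_pM2r m_gt0) -ler_sqr ?nnegrE ?mulr_ge0 ?(ltW m_gt0) ?(ltW e1_gt0) //.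
by move: h; rewrite !exprMn; lra.
Qed.

(** The [t1] part of the decrease alone gives D^2 <= 2 m e1^2 / (t1 M1), whence the second threshold
    on mu. *)
Lemma step_le_eps3 : m <= t1 * M1 / 2 * e2 -> D <= e1 * Num.sqrt e2.
Proof.
move=> hm; have M1p := M1_gt0.
rewrite -ler_sqr ?nnegrE ?mulr_ge0 ?sqrtr_ge0 ?(ltW e1_gt0) //.
rewrite exprMn sqr_sqrtr ?(ltW e2_gt0) //.
have dec := scaled_decrease.
have c : 0 < m * (t1 * M1) by rewrite !mulr_gt0.
rewrite -(ler_pM2l c).
have h1 : 0 <= t2 * lam * D ^+ 2 * M1.
  by rewrite !mulr_ge0 ?sqr_ge0 ?(ltW t2_gt0) ?(ltW M1p).
have := ler_wpM2l (mulr_ge0 (ltW m_gt0) (sqr_ge0 e1)) hm; lra.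
Qed.

(** The [t2] part of the decrease gives lam D^2 <= 2 m^2 e1^2 / (t2 M1). The m^2 absorbs the factor
    1/(2 m), so the whole residual is linear in m, and the first threshold on mu is the inverse of
    its slope. *)
Lemma complementarity_le_eps2 (a N r c : R) : 0 < a -> 0 <= N -> 0 <= l ->
  r <= N -> 0 <= c -> m <= M1 / (a * M1 * l + (N + m0 * c) / t2 * e1 ^+ 2) * e2 ->
  lam * (a * m + (r / (2 * m) + c / 2) * D ^+ 2) <= e2.
Proof.
move=> a0 N0 l0 rN c0 hm; have M1p := M1_gt0.
have e1sq : 0 < e1 ^+ 2 by rewrite exprn_gt0.
have m0p : 0 < m0 := lt_le_trans m_gt0 m_le.
pose S := N + m0 * c.
have S0 : 0 <= S by rewrite addr_ge0 // mulr_ge0 // ltW.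
have rS : r + m * c <= S by rewrite lerD // ler_wpM2r.
have lD : lam * D ^+ 2 * (M1 * t2) <= 2 * m ^+ 2 * e1 ^+ 2.
  have h1 : 0 <= t1 * m * D ^+ 2 * M1.
    by rewrite !mulr_ge0 ?sqr_ge0 ?(ltW t1_gt0) ?(ltW M1p) ?(ltW m_gt0).
  have := scaled_decrease; lra.
have q0 : 0 <= lam * D ^+ 2 by rewrite mulr_ge0 ?sqr_ge0.
have h2 : lam * ((r / (2 * m) + c / 2) * D ^+ 2) <= S / t2 * e1 ^+ 2 / M1 * m.
  have -> : lam * ((r / (2 * m) + c / 2) * D ^+ 2) =
     (r + m * c) * (lam * D ^+ 2) / (2 * m) by field; rewrite gt_eqF.
  rewrite ler_pdivrMr ?mulr_gt0 // (le_trans (ler_wpM2r q0 rS)) //.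
  have -> : S / t2 * e1 ^+ 2 / M1 * m * (2 * m) =
     S * (2 * m ^+ 2 * e1 ^+ 2 / (M1 * t2)) by field; rewrite !gt_eqF.
  by rewrite ler_wpM2l // ler_pdivlMr ?mulr_gt0.
have h3 : lam * (a * m) <= l * (a * m).
  by rewrite ler_wpM2r // mulr_ge0 // ltW.
have den0 : 0 <= a * M1 * l + S / t2 * e1 ^+ 2.
  rewrite addr_ge0 // !mulr_ge0 ?invr_ge0 //; exact: ltW.
(* A zero denominator has inverse 0, and [hm] would then contradict 0 < m. *)
have [den|den] := eqVneq (a * M1 * l + S / t2 * e1 ^+ 2) 0.
  by move: hm; rewrite -/S den invr0 mulr0 mul0r leNgt m_gt0.
have denp : 0 < a * M1 * l + S / t2 * e1 ^+ 2 by rewrite lt_neqAle eq_sym den.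
rewrite mulrDr (le_trans (lerD h3 h2)) //.
have -> : l * (a * m) + S / t2 * e1 ^+ 2 / M1 * m =
   m * (a * M1 * l + S / t2 * e1 ^+ 2) / M1 by field; rewrite !gt_eqF.
by rewrite ler_pdivrMr // -ler_pdivlMr // -mulrA mulrC.
Qed.

End KKTArithmetic.

(** * The algorithm *)

Section Data.
Context {R : realType} {X Y : finHilbertType R}.
Variables (p : problem X Y) (Lf LG : R) (x0 : X) (B : set Y) (s : smoothing Y).
Variables (q : params R) (mu : nat -> R).
Hypothesis hA : assumptionA p Lf LG x0.
Hypothesis B_compact : compact B.
Hypothesis B_base : is_base (polar (K_of p)) B.
Hypothesis hB : assumptionB B s.
Hypothesis hq : valid_params q.
Hypothesis mu0_gt0 : 0 < mu 0%N.
Implicit Types (x y d : X) (u w : Y) (m : R).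
Local Notation f := (f_of p).
Local Notation P1 := (P1_of p).
Local Notation P2 := (P2_of p).
Local Notation G := (G_of p).
Local Notation K := (K_of p).
Local Notation gm := (gmu p s).
Local Notation MB := (M_B B).
Local Notation MG := (M_G p x0).
Local Notation MR := (M_R p x0 B q mu).
Local Notation MGh := (M_G_hat p x0 B q mu).
Local Notation L := (L_ p LG x0 B s q mu).

(** * Smoothing functions, and bounds by the constants *)

Lemma base_neq0 : B !=set0.
Proof.
case: B_base => _ _ polE.
have : polar K (0 : Y) by move=> w _; rewrite inner0l.
by rewrite polE => -[t _ [u Bu _]]; exists u.
Qed.

Lemma base_polar u : B u -> polar K u.
Proof.
by case: B_base => _ _ -> Bu; exists 1 => //=; exists u => //; rewrite scale1r.
Qed.

Lemma h_diff m (y : Y) : 0 < m -> differentiable (h_of s m) y.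
Proof. by move=> m0; have [/(_ y)] := B_C1 hB m0. Qed.

Lemma h_grad_le m (y z : Y) : 0 < m ->
  h_of s m y + inner (grad (h_of s m) y) (z - y) <= h_of s m z.
Proof.
move=> m0; rewrite -gradP; apply: convex_diff_le; last exact: h_diff.
exact: (B_convex hB m0).
Qed.

Lemma h_grad_lipschitz m (y z : Y) : 0 < m ->
  `|grad (h_of s m) y - grad (h_of s m) z| <=
    (alpha1 s + alpha2 s / m) * `|y - z|.
Proof. by move=> m0; have /(_ (y, z) (conj I I)) := B_lipschitz hB m0. Qed.

Lemma h_grad_base m (y : Y) : 0 < m -> B (grad (h_of s m) y).
Proof.
move=> m0; set w := grad _ _; pose c := inner w y - h_of s m y + alpha3 s * m.
apply: (support_fun_mem B B_compact w c base_neq0); first by case: B_base.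
move=> z; have := h_grad_le m y z m0; rewrite -/w innerBr /c.
by have /andP[_] := B_approx hB z m0; lra.
Qed.

(** The gradient inequality towards 0, where the support function is nonpositive and hence h_mu at
    most alpha3 mu. *)
Lemma h_le_grad m (y : Y) : 0 < m ->
  h_of s m y <= alpha3 s * m + inner (grad (h_of s m) y) y.
Proof.
move=> m0; have := h_grad_le m y 0 m0; rewrite sub0r innerNr.
have := B_approx hB 0 m0.
have : support_fun B 0 <= 0.
  by apply: support_fun_le base_neq0 _ => u _; rewrite inner0l.
by move=> h0 /andP[_ h1] h2; lra.
Qed.

Lemma G_diff x : differentiable G x.
Proof. by have [[]] := A_G hA. Qed.

Lemma gmu_diff m x : 0 < m -> differentiable (gm m) x.
Proof.
by move=> m0; apply: differentiable_comp; [exact: G_diff|exact: h_diff].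
Qed.

Lemma grad_gmu m x : 0 < m ->
  grad (gm m) x = adjoint ('d G x) (grad (h_of s m) (G x)).
Proof.
move=> m0; apply: grad_unique => v.
rewrite [gm m](_ : _ = h_of s m \o G) // diff_comp; [|exact: G_diff|exact: h_diff].
by rewrite /= gradP innerC adjointP innerC.
Qed.

Lemma gmu_feasible m x : 0 < m -> gm m x <= 0 -> feasible p x.
Proof.
move=> m0 gx; have [k Kk] := A_interior hA.
apply: (bipolar K B) => //; [exact: A_cone hA|exact: A_closed hA|
  exact: A_convex hA|by exists k; exact: interior_subset|].
move=> u Bu; apply: le_trans (le_support_fun B B_compact (G x) u Bu) _.
by have /andP[h _] := B_approx hB (G x) m0; exact: le_trans h gx.
Qed.

Lemma gmu_anti m m' x : 0 < m -> m < m' -> gm m x <= gm m' x - alpha4 s * (m' - m).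
Proof. exact: (B_monotone hB). Qed.

Lemma g_B_le m x : 0 < m -> g_B p B x <= gm m x.
Proof. by move=> /(B_approx hB (G x)) /andP[]. Qed.

Lemma g_B_feasible x : feasible p x -> g_B p B x <= 0.
Proof.
move=> Fx; apply: support_fun_le base_neq0 _ => u /base_polar.
by rewrite innerC; exact.
Qed.

(** Comparing an element with a [sup] requires an upper bound of the set. For the constants taken
    over [Omega0] and its enlargements, the bounds start from this radius. *)
Lemma Omega0_bound : exists2 r, 0 <= r & forall x, Omega0 p x0 x -> `|x| <= r.
Proof.
have [M [_ hM]] := A_bounded hA.
exists (`|M| + 1) => [|x]; first by rewrite addr_ge0.
by apply: hM; rewrite ltr_pwDr // ler_norm.
Qed.

Lemma Omega0_x0 : Omega0 p x0 x0.
Proof. by split=> //; exact: interior_subset (A_slater hA). Qed.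

Lemma DG_bounded (r : R) : exists M, forall x, `|x| <= r -> opnorm ('d G x) <= M.
Proof.
exists (opnorm ('d G 0) + LG * r) => x xr.
apply: le_trans (smooth_opnorm_le Y LG G x (A_LG hA) (A_G hA)) _.
by rewrite lerD2l ler_wpM2l // (A_LG hA).
Qed.

Lemma M_G_ge x : Omega0 p x0 x -> opnorm ('d G x) <= MG.
Proof.
move=> Ox; have [r _ hr] := Omega0_bound; have [M MP] := DG_bounded r.
apply: sup_ge; last by exists x.
by exists M => _ [y Oy <-]; apply: MP; exact: hr.
Qed.

Lemma M_G_ge0 : 0 <= MG.
Proof. exact: le_trans (opnorm_ge0 _) (M_G_ge x0 Omega0_x0). Qed.

Lemma M_f_ge x : Omega0 p x0 x -> `|grad f x| <= M_f p x0.
Proof.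
move=> Ox; have [r _ hr] := Omega0_bound.
apply: sup_ge; last by exists x.
exists (`|grad f 0| + Lf * r) => _ [y Oy <-].
have := smooth_grad_lipschitz Lf f y 0 (A_f hA); rewrite subr0 => h.
rewrite -[grad f y](subrK (grad f 0)) addrC (le_trans (ler_normD _ _)) //.
by rewrite lerD2l (le_trans h) // ler_wpM2l ?hr // ltW // (A_Lf hA).
Qed.

Lemma M_P2_ge x xi : Omega0 p x0 x -> subdiff P2 x xi -> `|xi| <= M_P2 p x0.
Proof.
move=> Ox Sx; have [r _ hr] := Omega0_bound.
have [M _ MP] := subdiff_bounded P2 r (A_P2 hA).
apply: sup_ge; last by exists xi => //; exists x.
by exists M => _ [z [y Oy Sz] <-]; apply: (MP y) => //; exact: hr.
Qed.

Lemma M_R_ge0 : 0 <= MR.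
Proof.
case: hq => _ _ Lc0 _.
rewrite /M_R addr_ge0 ?sqrtr_ge0 ?mulr_ge0 ?invr_ge0 ?M_G_ge0 ?M_B_ge0 //.
- exact: ltW.
- exact: ltW.
Qed.

Lemma Omega0_hat_bound : exists2 r, 0 <= r &
  forall x, Omega0_hat p x0 B q mu x -> `|x| <= r.
Proof.
have [r r0 hr] := Omega0_bound.
exists (r + MR) => [|_ [x Ox [v /= vM <-]]]; first by rewrite addr_ge0 ?M_R_ge0.
by rewrite (le_trans (ler_normD _ _)) // lerD // hr.
Qed.

Lemma Omega0_hat_near x d : Omega0 p x0 x -> `|d| <= MR ->
  Omega0_hat p x0 B q mu (x + d).
Proof. by move=> Ox dM; exists x => //; exists d. Qed.

Lemma Omega0_sub_hat : Omega0 p x0 `<=` Omega0_hat p x0 B q mu.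
Proof.
move=> x Ox; rewrite -[x]addr0; apply: Omega0_hat_near => //.
by rewrite normr0 M_R_ge0.
Qed.

Lemma M_P1_ge x zeta : Omega0_hat p x0 B q mu x -> subdiff P1 x zeta ->
  `|zeta| <= M_P1 p x0 B q mu.
Proof.
move=> Ox Sx; have [r _ hr] := Omega0_hat_bound.
have [M _ MP] := subdiff_bounded P1 r (A_P1 hA).
apply: sup_ge; last by exists zeta => //; exists x.
by exists M => _ [z [y Oy Sz] <-]; apply: (MP y) => //; exact: hr.
Qed.

Lemma M_G_hat_ge x : convex_hull (Omega0_hat p x0 B q mu) x ->
  opnorm ('d G x) <= MGh.
Proof.
move=> Ox; have [r _ hr] := Omega0_hat_bound; have [M MP] := DG_bounded r.
apply: sup_ge; last by exists x.
by exists M => _ [y Oy <-]; apply: MP; exact: convex_hull_bounded hr _ Oy.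
Qed.

Lemma M_G_hat_ge0 : 0 <= MGh.
Proof. by apply: sup_nneg => _ [x _ <-]; exact: opnorm_ge0. Qed.

Lemma g_B_inf_le x : Omega0 p x0 x -> g_B_inf p x0 B <= g_B p B x.
Proof.
move=> Ox; apply: ge_inf; last by exists x.
have [r r0 hr] := Omega0_bound; have [M MP] := DG_bounded r.
have M0 : 0 <= M by rewrite (le_trans (opnorm_ge0 ('d G 0))) // MP // normr0.
exists (- ((`|G 0| + M * r) * MB)) => _ [y Oy <-].
have [u Bu] := base_neq0.
apply: le_trans (le_support_fun B B_compact (G y) u Bu).
have Gy : `|G y| <= `|G 0| + M * r.
  rewrite -[G y](subrK (G 0)) addrC (le_trans (ler_normD _ _)) // lerD2l.
  rewrite -{1}[y]add0r; apply: mean_value_le; first exact: G_diff.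
  move=> t /andP[t0 t1]; apply: (le_trans (le_opnorm1 _ _ _)).
  rewrite ler_pM ?opnorm_ge0 // ?hr // MP // add0r normrZ ger0_norm //.
  by rewrite (le_trans (ler_wpM2l t0 (hr y Oy))) // ler_piMl.
rewrite lerNl -innerNl (le_trans (cauchy_schwarz _ _)) // normrN.
by rewrite ler_pM // M_B_ge.
Qed.

(** The point is that psi is bounded below on the feasible set. Outside [Omega0] it exceeds psi x0;
    on [Omega0], [P1] and [P2] are bounded by convexity, and [f] by the descent lemma from y to
    0. *)
Lemma optval_le x : feasible p x -> optval p <= psi p x.
Proof.
move=> Fx; apply: ge_inf; last by exists x.
have [r r0 hr] := Omega0_bound.
have [M1 M1P] := convex_bounded P1 r (A_P1 hA).
have [M2 M2P] := convex_bounded P2 r (A_P2 hA).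
pose c := f 0 - (M_f p x0 * r + Lf / 2 * r ^+ 2) - M1 - M2.
exists (Num.min (psi p x0) c) => _ [y Fy <-].
have [py|py] := leP (psi p y) (psi p x0); last by rewrite ge_min (ltW py).
have Oy : Omega0 p x0 y by split.
rewrite ge_min; apply/orP; right; rewrite /c /psi.
have := M1P y (hr y Oy); rewrite ler_norml => /andP[h1 _].
have := M2P y (hr y Oy); rewrite ler_norml => /andP[_ h2].
have := smooth_descent Lf f y (- y) (A_f hA); rewrite subrr normrN.
have := cauchy_schwarz (grad f y) (- y); rewrite normrN.
have h3 : `|grad f y| * `|y| <= M_f p x0 * r by rewrite ler_pM // ?M_f_ge // hr.
have h4 : Lf / 2 * `|y| ^+ 2 <= Lf / 2 * r ^+ 2.
  rewrite ler_wpM2l //; first by rewrite divr_ge0 // ltW // (A_Lf hA).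
  by rewrite lerXn2r ?nnegrE // hr.
lra.
Qed.

Lemma L_ge0 m : 0 < m -> 0 <= L m.
Proof.
move=> m0; have a2 := ltW (B_alpha2 hB).
by rewrite /L_ !addr_ge0 ?divr_ge0 ?mulr_ge0 ?exprn_ge0 ?M_B_ge0 ?M_G_hat_ge0
  ?(A_LG hA) ?(B_alpha1 hB) ?a2 ?(ltW m0).
Qed.

(** m * L m is affine in m with nonnegative slope, so mu_0 * L mu_0 dominates it for every later
    mu. *)
Lemma scaled_L_le m m' : 0 < m -> m <= m' -> m * L m <= m' * L m'.
Proof.
move=> m0 mm'; have m'0 : 0 < m' := lt_le_trans m0 mm'.
have e k : 0 < k ->
    k * L k = k * (MB * LG + alpha1 s * MGh ^+ 2) + alpha2 s * MGh ^+ 2.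
  by move=> k0; rewrite /L_; field; rewrite gt_eqF.
rewrite !e // lerD2r ler_wpM2r // addr_ge0 // mulr_ge0 ?sqr_ge0 ?M_B_ge0 //.
  exact: (A_LG hA).
exact: (B_alpha1 hB).
Qed.

Lemma grad_gmu_norm m x : 0 < m -> Omega0 p x0 x -> `|grad (gm m) x| <= MG * MB.
Proof.
move=> m0 Ox; rewrite grad_gmu // (le_trans (adjoint_norm _ _)) //.
rewrite ler_pM ?opnorm_ge0 ?M_G_ge // M_B_ge //; exact: h_grad_base.
Qed.

(** The segment from y to x has to stay where 'd G is bounded; hence the convex hull in
    [M_G_hat]. *)
Lemma G_lipschitz x y :
  convex_hull (Omega0_hat p x0 B q mu) x ->
  convex_hull (Omega0_hat p x0 B q mu) y ->
  `|G x - G y| <= MGh * `|x - y|.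
Proof.
move=> hx hy; have -> : G x = G (y + (x - y)) by rewrite addrC subrK.
apply: mean_value_le; first exact: G_diff.
move=> t t01; apply: (le_trans (le_opnorm1 _ _ _)).
rewrite ler_wpM2r // M_G_hat_ge //.
exact: conv_comb (convex_hull_convex _) hy hx t01.
Qed.

(** The change of 'd G at a fixed gradient of h_mu, which is at most [M_B] in norm, gives the term
    M_B LG of [L_]. The change of that gradient at a fixed derivative passes through 'd G twice and
    gives the terms in M_G_hat^2. *)
Lemma grad_gmu_lipschitz m x y : 0 < m ->
  convex_hull (Omega0_hat p x0 B q mu) x ->
  convex_hull (Omega0_hat p x0 B q mu) y ->
  `|grad (gm m) x - grad (gm m) y| <= L m * `|x - y|.
Proof.
move=> m0 hx hy; rewrite !grad_gmu //.
set wx := grad _ (G x); set wy := grad _ (G y).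
have -> : adjoint ('d G x) wx - adjoint ('d G y) wy =
    (adjoint ('d G x) wx - adjoint ('d G y) wx) + adjoint ('d G y) (wx - wy).
  by rewrite adjointB addrA subrK.
rewrite (le_trans (ler_normD _ _)) //.
have h1 : `|adjoint ('d G x) wx - adjoint ('d G y) wx| <= LG * `|x - y| * MB.
  rewrite (le_trans (adjointB_norm _ _ _ _ ((A_G hA).2 x y))) //.
  rewrite ler_wpM2l ?mulr_ge0 ?(A_LG hA) // M_B_ge //; exact: h_grad_base.
have a0 : 0 <= alpha1 s + alpha2 s / m.
  by rewrite addr_ge0 ?(B_alpha1 hB) // divr_ge0 // ltW // (B_alpha2 hB).
have h2 : `|adjoint ('d G y) (wx - wy)| <=
    MGh * ((alpha1 s + alpha2 s / m) * (MGh * `|x - y|)).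
  rewrite (le_trans (adjoint_norm _ _)) // ler_pM ?opnorm_ge0 ?M_G_hat_ge //.
  by rewrite (le_trans (h_grad_lipschitz _ _ _ m0)) // ler_wpM2l // G_lipschitz.
by rewrite /L_; lra.
Qed.

Lemma gmu_descent m x d : 0 < m ->
  convex_hull (Omega0_hat p x0 B q mu) x ->
  convex_hull (Omega0_hat p x0 B q mu) (x + d) ->
  gm m (x + d) <= gm m x + inner (grad (gm m) x) d + L m / 2 * `|d| ^+ 2.
Proof.
move=> m0 hx hd; rewrite -gradP; apply: descent_lemma.
  by move=> y; exact: gmu_diff.
move=> t /[dup] t01 /andP[t0 t1]; rewrite !gradP -innerBl.
rewrite (le_trans (cauchy_schwarz _ _)) // expr2 !mulrA ler_wpM2r //.
have hxt : convex_hull (Omega0_hat p x0 B q mu) (x + t *: d).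
  have := conv_comb _ _ _ _ (convex_hull_convex _) hx hd t01.
  by rewrite [x + d]addrC addrK.
rewrite (le_trans (grad_gmu_lipschitz _ _ _ m0 hxt hx)) //.
by rewrite [x + _]addrC addrK normrZ (ger0_norm t0) mulrA.
Qed.

(** * Estimates at one trial point *)

Section Step.
Variables (m : R) (xk xi xt : X) (Lfk Lgk lam : R).
Hypothesis m_gt0 : 0 < m.
Hypothesis m_le : m <= mu 0%N.
Hypothesis xk_in : Omega0 p x0 xk.
Hypothesis gxk : gm m xk <= 0.
Hypothesis xi_sub : subdiff P2 xk xi.
Hypothesis Lfk_ge : Lcheck q <= Lfk.
Hypothesis Lgk_ge : Lcheck q <= Lgk.
Hypothesis xt_sub : g_sub p s m xk Lgk xt <= 0.
Hypothesis lam_mult :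
  is_multiplier (psi_sub p xk xi Lfk) (g_sub p s m xk Lgk) xt lam.
Local Notation d := (xt - xk).
Local Notation b := (grad (gm m) xk).

(** With c = mu_0 / Lcheck and a = M_G M_B, model feasibility alone gives |d|^2 / (2 c) <= a |d| -
    g. Completing the square yields [M_R], whether or not the trial point is accepted. *)
Lemma trial_dist : `|d| <= MR.
Proof.
have [_ _ Lc0 _] := hq; set D := `|d|; set a := MG * MB; set g := g_B_inf p x0 B.
pose c := mu 0%N / Lcheck q.
have c0 : 0 < c by rewrite divr_gt0.
have a0 : 0 <= a by rewrite mulr_ge0 ?M_G_ge0 ?M_B_ge0.
have h1 : g <= gm m xk.
  by rewrite (le_trans (g_B_inf_le _ xk_in)) // g_B_le.
have h2 : - (a * D) <= inner b d.
  rewrite lerNl -innerNl (le_trans (cauchy_schwarz _ _)) // normrN.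
  by rewrite ler_wpM2r // grad_gmu_norm.
have h3 : Lgk / (2 * m) * D ^+ 2 <= a * D - g.
  by move: xt_sub; rewrite /g_sub -/D; lra.
have h4 : c^-1 / 2 * D ^+ 2 <= a * D - g.
  apply: le_trans h3; rewrite ler_wpM2r ?sqr_ge0 //.
  have -> : Lgk / (2 * m) = Lgk / m / 2 by field; rewrite gt_eqF.
  rewrite ler_wpM2r // /c invf_div ler_pM ?invr_ge0 // ?(ltW Lc0) ?(ltW mu0_gt0) //.
  by rewrite lef_pV2 ?posrE.
have h5 : (D - c * a) ^+ 2 <= c ^+ 2 * a ^+ 2 - 2 * c * g.
  have : 2 * c * (c^-1 / 2 * D ^+ 2) <= 2 * c * (a * D - g).
    by rewrite ler_pM2l // mulr_gt0.
  have -> : 2 * c * (c^-1 / 2 * D ^+ 2) = D ^+ 2 by field; rewrite gt_eqF.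
  by move=> h; rewrite sqrrB; lra.
rewrite /M_R -/g.
have -> : mu 0%N / Lcheck q * MG * MB = c * a by rewrite /a mulrA.
have -> : mu 0%N ^+ 2 / Lcheck q ^+ 2 * MG ^+ 2 * MB ^+ 2
    - 2 * mu 0%N / Lcheck q * g = c ^+ 2 * a ^+ 2 - 2 * c * g.
  by rewrite /c /a; field; rewrite gt_eqF.
rewrite -lerBlDr (le_trans (ler_norm _)) // -sqrtr_sqr.
exact: ler_wsqrtr.
Qed.

Lemma trial_in_hat : Omega0_hat p x0 B q mu xt.
Proof. by rewrite -(subrK xk xt) addrC; exact: Omega0_hat_near trial_dist. Qed.

(** Past this threshold the model majorises [gm m] at the trial point. *)
Lemma trial_feasible : m * L m <= Lgk -> gm m xt <= 0.
Proof.
move=> mL; have e : xt = xk + d by rewrite addrC subrK.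
have hk := convex_hull_sub _ _ (Omega0_sub_hat _ xk_in).
have ht := convex_hull_sub _ _ trial_in_hat.
have := gmu_descent m xk d m_gt0 hk; rewrite -e => /(_ ht).
have : L m / 2 * `|d| ^+ 2 <= Lgk / (2 * m) * `|d| ^+ 2.
  rewrite ler_wpM2r ?sqr_ge0 // ler_pdivlMr ?mulr_gt0 //.
  by move: mL; rewrite [m * _]mulrC; lra.
by move: xt_sub; rewrite /g_sub; lra.
Qed.

Lemma grad_g_sub : grad (g_sub p s m xk Lgk) xt = b + (Lgk / m) *: d.
Proof.
apply: (@grad_quadratic _ _ _ _ _ (Lgk / (2 * m))) => v; rewrite /g_sub.
have -> : xt + v - xk = d + v by rewrite addrAC.
rewrite (normD_sqr d v) (innerDr b d) (innerDl b) innerZl.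
by field; rewrite gt_eqF.
Qed.

Lemma stationarity : exists2 zeta, subdiff P1 xt zeta &
  zeta + (grad f xk - xi) + Lfk *: d + lam *: (b + (Lgk / m) *: d) = 0.
Proof.
have [_ _ [z zs z0]] := lam_mult.
exists (z - (grad f xk - xi) - Lfk *: d).
  exact: subdiff_quadratic (A_P1 hA) zs.
move: z0; rewrite grad_g_sub => <-.
set c := lam *: _.
exact (congr1 (fun v : X => v + c) (subr2K z (grad f xk - xi) (Lfk *: d))).
Qed.

Lemma complementarity :
  lam * (gm m xk + inner b d + Lgk / (2 * m) * `|d| ^+ 2) = 0.
Proof. by have [_] := lam_mult. Qed.

(** Convexity of [P1] and [P2], the descent lemma for [f] and stationarity paired with d are added
    up. The gradient of the quadratic constraint term paired with d is twice that term;
    complementarity uses one copy, and the other is left to pay for the [tau2] part. *)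
Lemma trial_descent : Lf + tau1 q <= Lfk -> tau2 q <= Lgk ->
  psi p xt <= psi p xk
    - (tau1 q * m + tau2 q * lam) / (2 * m) * `|d| ^+ 2.
Proof.
move=> hf hg; have [lam0 _ _] := lam_mult; have [_ _ Lc0 _] := hq.
have h7 : lam * (Lgk / m) * `|d| ^+ 2 = 2 * (lam * (Lgk / (2 * m) * `|d| ^+ 2)).
  by field; rewrite gt_eqF.
have h8 : (tau1 q * m + tau2 q * lam) / (2 * m) * `|d| ^+ 2 <=
   (Lfk - Lf) / 2 * `|d| ^+ 2 + lam * (Lgk / (2 * m) * `|d| ^+ 2).
  have -> : (tau1 q * m + tau2 q * lam) / (2 * m) =
      tau1 q / 2 + lam * (tau2 q / (2 * m)) by field; rewrite gt_eqF.
  have p1 : 0 <= (Lfk - Lf - tau1 q) / 2 * `|d| ^+ 2.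
    by rewrite mulr_ge0 ?sqr_ge0 // divr_ge0 //; lra.
  have p2 : 0 <= lam * ((Lgk - tau2 q) / (2 * m)) * `|d| ^+ 2.
    rewrite mulr_ge0 ?sqr_ge0 // mulr_ge0 // divr_ge0 ?subr_ge0 //.
    by rewrite mulr_ge0 // ltW.
  lra.
have [zeta zs stat] := stationarity.
have e : xt = xk + d by rewrite addrC subrK.
have h2 := inner_stationarity _ _ _ _ _ _ _ _ d stat; rewrite inner_normE in h2.
have := zs xk; rewrite -(opprB xt xk) innerNr => h1.
have h3 := smooth_descent Lf f xk d (A_f hA); rewrite -e in h3.
have h4 := xi_sub xt.
have h5 := complementarity.
have h6 : lam * gm m xk <= 0 by rewrite mulr_ge0_le0.
have h9 : 0 <= Lfk * `|d| ^+ 2.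
  by rewrite mulr_ge0 ?sqr_ge0 // (le_trans _ Lfk_ge) // ltW.
exact: (descent_arith _ _ _ _ _ _ _ _ _ _ _ _ _ _ _ _ _ _ _ h1 h2 h3 h4 h5 h6 h7 h8 h9).
Qed.

(* Here [b + r d], with [r = Lgk / m], is the gradient of the constraint at the
   trial point; when the constraint is active its squared norm is
   [|b|^2 - 2 r (gm m xk)].  Pairing the stationarity condition with it and using
   [<d, b + r d> >= - |b|^2 / (4 r)] bounds the multiplier. *)
Lemma multiplier_le (e C : R) : 0 < e ->
  e ^+ 2 <= `|b| ^+ 2 - 2 * (Lgk / m) * gm m xk -> Lfk <= C ->
  lam <= (M_f p x0 + M_P1 p x0 B q mu + M_P2 p x0) / e
         + C * MG ^+ 2 * MB ^+ 2 * mu 0%N / (2 * Lcheck q * e ^+ 2).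
Proof.
move=> e0 he hC; set S := _ + _ + M_P2 _ _.
set a := MG * MB; set N := `|b + (Lgk / m) *: d|.
have [_ _ Lc0 _] := hq; have [lam0 _ _] := lam_mult.
have C0 : 0 <= C by rewrite (le_trans (le_trans (ltW Lc0) Lfk_ge)).
have a0 : 0 <= a by rewrite mulr_ge0 ?M_G_ge0 ?M_B_ge0.
have [zeta zs stat] := stationarity.
have h1 : `|zeta| <= M_P1 p x0 B q mu := M_P1_ge _ _ trial_in_hat zs.
have h2 : `|grad f xk| <= M_f p x0 := M_f_ge _ xk_in.
have h3 : `|xi| <= M_P2 p x0 := M_P2_ge _ _ xk_in xi_sub.
have S0 : 0 <= S.
  by rewrite !addr_ge0 ?(le_trans _ h1) ?(le_trans _ h2) ?(le_trans _ h3).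
have hb : `|b| <= a := grad_gmu_norm _ _ m_gt0 xk_in.
have T0 : 0 <= C * a ^+ 2 * mu 0%N / (2 * Lcheck q).
  apply: divr_ge0 (mulr_ge0 (mulr_ge0 C0 (sqr_ge0 a)) (ltW mu0_gt0)) _.
  by rewrite mulr_ge0 // ltW.
have -> : S / e + C * MG ^+ 2 * MB ^+ 2 * mu 0%N / (2 * Lcheck q * e ^+ 2) =
    S / e + C * a ^+ 2 * mu 0%N / (2 * Lcheck q) / e ^+ 2.
  by rewrite /a; field; rewrite !gt_eqF.
move: lam0; rewrite le_eqVlt => /predU1P[<-|lam0].
  by rewrite addr_ge0 // divr_ge0 ?sqr_ge0 // ltW.
have r0 : 0 < Lgk / m by rewrite divr_gt0 // (lt_le_trans Lc0).
have N2 : N ^+ 2 = `|b| ^+ 2 - 2 * (Lgk / m) * gm m xk.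
  have := complementarity; move/eqP; rewrite mulf_eq0 gt_eqF //= => /eqP.
  have -> : Lgk / (2 * m) = Lgk / m / 2 by field; rewrite gt_eqF.
  by rewrite /N norm_linear_sqr; exact: active_arith.
have N0 : 0 <= N by exact: normr_ge0.
have eN : e <= N by rewrite -ler_sqr ?nnegrE ?(ltW e0) ?N0 ?N2.
apply: (multiplier_arith _ N) => //.
have stat' := inner_stationarity _ _ _ _ _ _ _ _ (b + (Lgk / m) *: d) stat.
have NE : inner b (b + (Lgk / m) *: d) + (Lgk / m) * inner d (b + (Lgk / m) *: d)
    = N ^+ 2 by rewrite -innerZl -innerDl inner_normE.
have cs (z : X) k : `|z| <= k -> inner z (b + (Lgk / m) *: d) <= k * N.
  by move=> zk; rewrite (le_trans (cauchy_schwarz _ _)) // ler_wpM2r.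
apply: (pairing_arith _ _ _ _ _ _ _ _ _ _ _ _ _ _ stat' NE).
- by rewrite -innerNl cs // normrN.
- by rewrite -innerNl cs // normrN.
- exact: cs.
have := inner_linear_ge b d (Lgk / m); set dv := inner d _; set r := Lgk / m.
rewrite lerNl => hdv.
have rV : r^-1 <= mu 0%N / Lcheck q.
  rewrite /r invf_div ler_pM ?invr_ge0 ?(ltW m_gt0) ?(le_trans (ltW Lc0)) //.
  by rewrite lef_pV2 ?posrE // (lt_le_trans Lc0).
have b2 : `|b| ^+ 2 / 4 <= a ^+ 2 / 2.
  rewrite ler_pM ?sqr_ge0 ?invr_ge0 ?lerXn2r ?nnegrE //.
  by rewrite lef_pV2 ?posrE // ler_nat.
apply: (@le_trans _ _ (Lfk * (`|b| ^+ 2 / 4 * r^-1))).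
  rewrite -mulrN ler_wpM2l ?(le_trans (ltW Lc0)) // ler_pdivlMr // mulNr.
  by rewrite mulrC.
have -> : C * a ^+ 2 * mu 0%N / (2 * Lcheck q) =
    C * (a ^+ 2 / 2 * (mu 0%N / Lcheck q)) by field; rewrite gt_eqF.
have Lfk0 : 0 <= Lfk := le_trans (ltW Lc0) Lfk_ge.
rewrite ler_pM ?mulr_ge0 ?divr_ge0 ?invr_ge0 ?sqr_ge0 ?(ltW r0) //.
by rewrite ler_pM ?divr_ge0 ?invr_ge0 ?sqr_ge0 ?(ltW r0).
Qed.

(** Stationarity is moved from xk to xt. Since [w] stays at the old point, the 1/m Lipschitz
    constant of the gradient of h_mu does not enter here. The four terms come from the gradient of
    [f], the proximal term, the change of 'd G, and the curvature of the constraint model. *)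
Lemma kkt_residual (w := grad (h_of s m) (G xk)) :
  exists2 zeta, subdiff P1 xt zeta &
  `|zeta - xi + grad f xt + adjoint ('d G xt) (lam *: w)| <=
    (Lf + Lfk + lam * LG * MB + lam * (Lgk / m)) * `|d|.
Proof.
have [lam0 _ _] := lam_mult; have [_ _ Lc0 _] := hq.
have [zeta zs stat] := stationarity; exists zeta => //.
rewrite adjointZ (stationarity_shift _ _ _ _ _ _ _ _ _ _ stat) grad_gmu //.
have h1 := smooth_grad_lipschitz Lf f xt xk (A_f hA).
have h2 : `|adjoint ('d G xt) w - adjoint ('d G xk) w| <= LG * `|d| * MB.
  rewrite (le_trans (adjointB_norm _ _ _ _ ((A_G hA).2 xt xk))) //.
  rewrite ler_wpM2l ?mulr_ge0 ?(A_LG hA) // M_B_ge //; exact: h_grad_base.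
have k0 : 0 <= Lfk + lam * (Lgk / m).
  apply: addr_ge0; first exact: le_trans (ltW Lc0) Lfk_ge.
  apply: mulr_ge0 lam0 (divr_ge0 _ (ltW m_gt0)).
  exact: le_trans (ltW Lc0) Lgk_ge.
rewrite (le_trans (ler_normD _ _)) // normrZ (ger0_norm lam0).
have h3 := ler_wpM2l lam0 h2.
have h4 := ler_normB (grad f xt - grad f xk) ((Lfk + lam * (Lgk / m)) *: d).
rewrite normrZ (ger0_norm k0) in h4; exact: residual_arith h1 h3 h4.
Qed.

(** Linearising <w, G> at xk costs the LG term, replacing <w, G xk> by [gm m xk] costs alpha3 m, and
    complementarity trades the linear model for its quadratic term. *)
Lemma complementarity_residual (w := grad (h_of s m) (G xk)) :
  - inner (lam *: w) (G xt) <=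
    lam * (alpha3 s * m + (Lgk / (2 * m) + LG * MB / 2) * `|d| ^+ 2).
Proof.
have [lam0 _ _] := lam_mult; have e : xt = xk + d by rewrite addrC subrK.
rewrite innerZl -mulrN -innerNl.
have h1 := smooth_inner_descent Y LG G xk d (- w) (A_G hA); rewrite -e normrN in h1.
have h2 : inner w ('d G xk d) = inner b d.
  by rewrite grad_gmu // innerC adjointP innerC.
rewrite !(innerNl w) h2 in h1 *.
have h3 : `|w| * LG / 2 * `|d| ^+ 2 <= MB * LG / 2 * `|d| ^+ 2.
  rewrite ler_wpM2r ?sqr_ge0 // ler_wpM2r // ler_wpM2r ?(A_LG hA) // M_B_ge //.
  exact: h_grad_base.
have h4 := h_le_grad m (G xk) m_gt0.
have h5 := complementarity.
exact: (complementarity_arith _ _ _ _ _ _ _ _ _ _ _ _ lam0 h1 h3 h4 h5).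
Qed.

End Step.

Local Notation ML := (M_L p Lf LG x0 B s q mu).
Local Notation A := (Num.max 2 (2 * (Lf + tau1 q) / Lcheck q)).
Local Notation C := (Num.max (Num.max 2 (2 * tau2 q / Lcheck q))
                             (2 * mu 0%N * L (mu 0%N) / Lcheck q)).

Lemma M_L_ge (k : R) : k <= A * C -> Lhat q * k <= ML.
Proof.
have [_ _ Lc0 Lch] := hq; move=> kAC.
by rewrite /M_L -mulrA ler_wpM2l // (le_trans (ltW Lc0)).
Qed.

Lemma max2_ge1 (a : R) : 1 <= Num.max 2 a.
Proof. by rewrite le_max (ler_nat R 1 2). Qed.

Lemma AC_ge1 : 1 <= A /\ 1 <= C.
Proof. by split; [|rewrite le_max; apply/orP; left]; exact: max2_ge1. Qed.

(** * Bounds on the backtracking parameters *)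

Section Backtracking.
Variables (m : R) (xk xi : X) (Lf0 Lg0 : R) (xt : nat -> nat -> X).
Variables (lam : nat -> nat -> R).
Hypothesis m_gt0 : 0 < m.
Hypothesis m_le : m <= mu 0%N.
Hypothesis xk_in : Omega0 p x0 xk.
Hypothesis gxk : gm m xk <= 0.
Hypothesis xi_sub : subdiff P2 xk xi.
Hypothesis Lf0_bd : Lcheck q <= Lf0 <= Lhat q.
Hypothesis Lg0_bd : Lcheck q <= Lg0 <= Lhat q.
Hypothesis trialP : forall i j, visited p s q m xk xt lam i j ->
  g_sub p s m xk (2 ^+ j * Lg0) (xt i j) <= 0 /\
  is_multiplier (psi_sub p xk xi (2 ^+ i * Lf0)) (g_sub p s m xk (2 ^+ j * Lg0))
    (xt i j) (lam i j).

Lemma pow2_ge1 (n : nat) : 1 <= 2 ^+ n :> R.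
Proof. by rewrite exprn_ege1 // ler1n. Qed.

Lemma pow2_scale (n : nat) (l : R) : Lcheck q <= l -> Lcheck q <= 2 ^+ n * l.
Proof.
move=> hl; have [_ _ Lc0 _] := hq.
by rewrite (le_trans hl) // ler_peMl ?pow2_ge1 // (le_trans (ltW Lc0)).
Qed.

(** A parameter is doubled only while below its threshold [k], so it overshoots by at most a factor
    2. Dividing by the least initial guess gives the quotients in [M_L]. *)
Lemma pow2_double (n : nat) (l k : R) : Lcheck q <= l -> 2 ^+ n * l < k ->
  2 ^+ n.+1 <= 2 * k / Lcheck q.
Proof.
move=> hl hk; have [_ _ Lc0 _] := hq.
rewrite ler_pdivlMr // exprS -mulrA ler_wpM2l // (le_trans _ (ltW hk)) //.
by rewrite ler_wpM2l // (le_trans ler01) // pow2_ge1.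
Qed.

(* [i] grows only together with [j], so the number of doublings of the constraint
   parameter is at most that of the objective parameter plus the number of
   doublings forced by [C]. *)
Lemma visited_bound i j : visited p s q m xk xt lam i j ->
  (i <= j)%N /\ (2 ^+ j <= C \/ 2 ^+ i <= A /\ 2 ^+ j <= C * 2 ^+ i).
Proof.
have [A1 C1] := AC_ge1; have C0 : 0 <= C := le_trans ler01 C1.
have /andP[Lfc _] := Lf0_bd; have /andP[Lgc _] := Lg0_bd.
have CA (n k : R) : 2 * tau2 q / Lcheck q = n \/
    2 * (mu 0%N * L (mu 0%N)) / Lcheck q = n -> k <= n -> k <= C.
  move=> hn kn; rewrite !le_max; case: hn => hn.
    by rewrite hn kn !orbT.
  by rewrite -[2 * _ * L _]mulrA hn kn !orbT.
elim=> {i j} [|i j vij [ij IH] nacc infeas|i j vij [ij IH] nacc feas].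
- by split=> //; left; rewrite expr0.
- split; first exact: leqW.
  have [hs hm] := trialP _ _ vij; left.
  apply: CA (or_intror erefl) _; apply: (pow2_double _ _ _ Lgc _).
  rewrite ltNge; apply/negP => hL.
  have : m * L m <= 2 ^+ j * Lg0 by rewrite (le_trans (scaled_L_le _ _ m_gt0 m_le)).
  move=> /(trial_feasible _ _ _ _ m_gt0 m_le xk_in (pow2_scale j _ Lgc) hs).
  by rewrite leNgt infeas.
- split; first by rewrite ltnS.
  have [hs hm] := trialP _ _ vij.
  have [hg|hg] := leP (tau2 q) (2 ^+ j * Lg0); last first.
    left; apply: CA (or_introl erefl) _; exact: (pow2_double _ _ _ Lgc hg).
  right; have hf : 2 ^+ i * Lf0 < Lf + tau1 q.
    rewrite ltNge; apply/negP => hf; apply: nacc; split.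
      by rewrite leNgt; apply/negP.
    exact: (trial_descent _ _ _ _ _ _ _ m_gt0 gxk xi_sub
      (pow2_scale i _ Lfc) hm hf hg).
  split; first by rewrite le_max (pow2_double _ _ _ Lfc hf) orbT.
  rewrite !exprS mulrCA ler_wpM2l //; case: IH => [IH|[_ //]].
  by rewrite (le_trans IH) // ler_peMr // pow2_ge1.
Qed.

(** 2^j is at most A C, and so is 2^i because i <= j; the initial guesses contribute the factor
    Lhat. *)
Lemma visited_le_M_L i j : visited p s q m xk xt lam i j ->
  2 ^+ i * Lf0 <= ML /\ 2 ^+ j * Lg0 <= ML.
Proof.
move=> /visited_bound[ij h].
have [A1 C1] := AC_ge1; have C0 : 0 <= C := le_trans ler01 C1.
have /andP[Lfc Lfh] := Lf0_bd; have /andP[Lgc Lgh] := Lg0_bd.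
have pow0 n : 0 <= 2 ^+ n :> R by rewrite (le_trans ler01) // pow2_ge1.
have hj : 2 ^+ j <= A * C.
  case: h => [h|[h1 h2]]; first by rewrite (le_trans h) // ler_peMl.
  by rewrite (le_trans h2) // mulrC ler_wpM2r.
have hi : 2 ^+ i <= A * C.
  by rewrite (le_trans _ hj) // ler_weXn2l // ler1n.
split; [rewrite (le_trans (ler_wpM2l (pow0 i) Lfh)) //|
  rewrite (le_trans (ler_wpM2l (pow0 j) Lgh)) //]; by rewrite mulrC M_L_ge.
Qed.

End Backtracking.

Lemma smba_stepP m xk x' : 0 < m -> m <= mu 0%N -> Omega0 p x0 xk ->
  gm m xk <= 0 -> smba_step p s q m xk x' ->
  exists (xi : X) (Lfk Lgk lam : R),
    [/\ subdiff P2 xk xi, Lcheck q <= Lfk <= ML, Lcheck q <= Lgk <= ML,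
        g_sub p s m xk Lgk x' <= 0 /\
        is_multiplier (psi_sub p xk xi Lfk) (g_sub p s m xk Lgk) x' lam
      & accepted p s q m xk x' lam].
Proof.
move=> m0 m1 Oxk gxk [xi [Lf0 [Lg0 [xt [lam [i [j [xs [hf hg] tP [vij acc] ->]]]]]]]].
have tP' i' j' : visited p s q m xk xt lam i' j' ->
    g_sub p s m xk (2 ^+ j' * Lg0) (xt i' j') <= 0 /\
    is_multiplier (psi_sub p xk xi (2 ^+ i' * Lf0))
      (g_sub p s m xk (2 ^+ j' * Lg0)) (xt i' j') (lam i' j').
  by move=> /tP [[]].
have [h1 h2] := visited_le_M_L _ _ _ _ _ _ _ m0 m1 Oxk gxk xs hf hg tP' _ _ vij.
exists xi, (2 ^+ i * Lf0), (2 ^+ j * Lg0), (lam i j).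
have /andP[Lfc _] := hf; have /andP[Lgc _] := hg.
by split=> //; [rewrite h1 pow2_scale|rewrite h2 pow2_scale|exact: tP'].
Qed.

(** * Invariants of the run and choice of the iteration *)

Section Run.
Variables (x : nat -> X) (eta : R) (tbar : nat).
Hypothesis hrun : smba_run p s q x0 mu x.
Hypothesis heta : eta_spec p x0 B eta.
Hypothesis htbar : tbar_spec s mu eta tbar.
Local Notation etab := (eta_bar p x0 s q mu eta tbar).
Local Notation Ml := (M_lambda p Lf LG x0 B s q mu eta tbar).
Local Notation M1 := (M1_bar p Lf LG x0 B s q mu eta tbar).
Local Notation M2 := (M2_bar p Lf LG x0 B s q mu).

Lemma mu_gt0 k : 0 < mu k.
Proof. by case: hrun => _ h0 _ h; case: k => [//|k]; have [_ /andP[]] := h k. Qed.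

Lemma mu_ltS k : mu k.+1 < mu k.
Proof. by case: hrun => _ _ _ h; have [_ /andP[]] := h k. Qed.

Lemma mu_anti i j : (i <= j)%N -> mu j <= mu i.
Proof.
elim: j => [|j IH]; first by rewrite leqn0 => /eqP ->.
rewrite leq_eqVlt => /predU1P[->//|ij].
exact: le_trans (ltW (mu_ltS j)) (IH ij).
Qed.

(** Acceptance gives [gm (mu k) (x k.+1) <= 0]; passing to the smaller mu lowers the value by alpha4
    (mu k - mu k.+1), so the next subproblem starts at a strictly feasible point. *)
Lemma iterate_invariant k : Omega0 p x0 (x k) /\ gm (mu k) (x k) < 0.
Proof.
have [x0E _ g0 step] := hrun.
elim: k => [|k [Ok gk]]; first by rewrite x0E; split=> //; exact: Omega0_x0.
have [sk _] := step k.
have [xi [Lfk [Lgk [lam [xis hf hg [gs mult] [gx' psi']]]]]] :=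
  smba_stepP _ _ _ (mu_gt0 k) (mu_anti _ _ (leq0n k)) Ok (ltW gk) sk.
split; last first.
  have := gmu_anti _ _ (x k.+1) (mu_gt0 k.+1) (mu_ltS k).
  have : 0 < alpha4 s * (mu k - mu k.+1).
    by rewrite mulr_gt0 ?subr_gt0 ?mu_ltS // (B_alpha4 hB).
  lra.
split; last exact: gmu_feasible (mu_gt0 k) gx'.
have [lam0 _ _] := mult; have [t1 t2 _ _] := hq.
apply: (le_trans psi'); apply: le_trans Ok.1; rewrite gerBl.
rewrite mulr_ge0 ?sqr_ge0 // divr_ge0 // ?mulr_ge0 // ?(ltW (mu_gt0 k)) //.
by rewrite addr_ge0 // mulr_ge0 // ltW // mu_gt0.
Qed.

Lemma psi_optval k : optval p <= psi p (x k) <= psi p x0.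
Proof.
by have [[h1 h2] _] := iterate_invariant k; rewrite h1 optval_le.
Qed.

Lemma c0_gt0 : 0 < c0 mu tbar.
Proof.
have pos t : 0 < mu t / mu t.+1 - 1.
  by rewrite subr_gt0 ltr_pdivlMr ?mu_gt0 // mul1r mu_ltS.
rewrite /c0 big_nat; apply: (big_ind (fun z => 0 < z)) => [|y z y0 z0|].
- exact: pos 0%N.
- by rewrite lt_min y0.
- by move=> [//|t] _; exact: pos.
Qed.

Lemma c0_le t : (0 < t <= tbar)%N -> c0 mu tbar <= mu t.-1 / mu t - 1.
Proof.
move=> tt; apply: (@ge_bigmin_seq _ _ _ _ _ t) => //.
by rewrite mem_index_iota ltnS.
Qed.

Lemma eta_bar_sqr : etab ^+ 2 =
  Num.min (Num.min eta (2 * alpha3 s * Lcheck q))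
          (Num.min (- 2 * (mu 0%N)^-1 * Lcheck q * gm (mu 0%N) x0)
                   (2 * c0 mu tbar * alpha4 s * Lcheck q)) /\ 0 < etab.
Proof.
have [_ _ Lc0 _] := hq; have [eta0 _] := heta; have [_ _ g0 _] := hrun.
have pos : 0 < Num.min (Num.min eta (2 * alpha3 s * Lcheck q))
          (Num.min (- 2 * (mu 0%N)^-1 * Lcheck q * gm (mu 0%N) x0)
                   (2 * c0 mu tbar * alpha4 s * Lcheck q)).
  have g1 : 0 < - 2 * (mu 0%N)^-1 * Lcheck q * gm (mu 0%N) x0.
    rewrite -mulrA -mulrA mulNr -mulrN -mulrN -mulrN.
    by rewrite mulr_gt0 // mulr_gt0 ?invr_gt0 // mulr_gt0 // oppr_gt0.
  rewrite !lt_min eta0 g1 !mulr_gt0 ?c0_gt0 //.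
    exact: B_alpha4 hB.
  exact: B_alpha3 hB.
by rewrite /eta_bar sqr_sqrtr ?(ltW pos) // sqrtr_gt0.
Qed.

Lemma eta_bar_le k Lgk : Lcheck q <= Lgk ->
  etab ^+ 2 <= `|grad (gm (mu k)) (x k)| ^+ 2 - 2 * (Lgk / mu k) * gm (mu k) (x k).
Proof.
move=> hL; have [_ _ Lc0 _] := hq; have [x0E _ _ step] := hrun.
have m0 := mu_gt0 k; have [Ok gk] := iterate_invariant k.
have [-> _] := eta_bar_sqr; set b := grad _ _.
have gN : 0 <= - gm (mu k) (x k) by rewrite oppr_ge0 ltW.
have r0 : 0 <= Lcheck q / mu k by rewrite divr_ge0 // ltW.
have r1 : Lcheck q / mu k <= Lgk / mu k by rewrite ler_wpM2r // invr_ge0 ltW.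
(* Any slack [t] proportional to mu k yields a bound free of mu, because the curvature is at least
   Lcheck / mu k. *)
have key (t : R) : 0 <= t -> t <= - gm (mu k) (x k) ->
    2 * (Lcheck q / mu k) * t <= `|b| ^+ 2 - 2 * (Lgk / mu k) * gm (mu k) (x k).
  move=> t0 ht; have := ler_pM r0 t0 r1 ht; have := sqr_ge0 `|b|; lra.
have [tk|kt] := leqP tbar k.
  have mk : mu k < eta / (2 * alpha3 s).
    by have [_ h _] := htbar; apply: le_lt_trans h; exact: mu_anti.
  rewrite ltr_pdivlMr ?mulr_gt0 ?(B_alpha3 hB) // in mk.
  have a3 := B_alpha3 hB.
  set w := grad (h_of s (mu k)) (G (x k)).
  have Bw : B w by exact: h_grad_base.
  (* A gradient that is not large forces - <w, G> > eta by [eta_spec]; as 2 alpha3 mu k < eta, the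
     slack is at least alpha3 mu k. *)
  have [b2|b2] := leP (`|b| ^+ 2) eta.
    have := heta.2 _ _ Ok Bw; rewrite -grad_gmu // -/b => nh.
    have hw : eta < - inner w (G (x k)).
      by rewrite ltNge; apply/negP => h; apply: nh.
    have hg := h_le_grad _ (G (x k)) m0; rewrite -/w in hg.
    rewrite !ge_min; apply/orP; left; apply/orP; right.
    have e : 2 * alpha3 s * Lcheck q = 2 * (Lcheck q / mu k) * (alpha3 s * mu k).
      by field; rewrite gt_eqF.
    rewrite e; apply: key; first by rewrite mulr_ge0 // ltW.
    by rewrite /gmu; lra.
  rewrite !ge_min (le_trans (ltW b2)) //.
  by have := mulr_ge0 (le_trans r0 r1) gN; lra.
have [k0|[j kj]] : k = 0%N \/ exists j, k = j.+1.
  by case: (k) => [|j]; [left|right; exists j].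
  subst k.
  rewrite !ge_min; apply/orP; right; apply/orP; left.
  have := key _ gN (lexx _); rewrite {1}x0E; apply: le_trans.
  by rewrite le_eqVlt; apply/orP; left; apply/eqP; field; rewrite gt_eqF.
rewrite !ge_min; apply/orP; right; apply/orP; right.
subst k.
(* For 0 < k < tbar the slack is the drop of h_mu from mu j to mu j.+1. Divided by mu j.+1 it
   becomes the relative decrease, whose minimum is [c0]. *)
have [sk _] := step j; have [Ok' gk'] := iterate_invariant j.
have [_ [_ [_ [_ [_ _ _ _ [gx _]]]]]] :=
  smba_stepP _ _ _ (mu_gt0 j) (mu_anti _ _ (leq0n j)) Ok' (ltW gk') sk.
have a4 := B_alpha4 hB.
have d0 : 0 <= alpha4 s * (mu j - mu j.+1).
  by rewrite mulr_ge0 ?subr_ge0 // ltW // mu_ltS.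
have := gmu_anti _ _ (x j.+1) (mu_gt0 j.+1) (mu_ltS j) => hm.
apply: le_trans (key _ d0 _); last by lra.
have := c0_le j.+1; rewrite (ltnW kt) => /(_ isT) /= hc.
have -> : 2 * (Lcheck q / mu j.+1) * (alpha4 s * (mu j - mu j.+1)) =
   2 * (mu j / mu j.+1 - 1) * alpha4 s * Lcheck q by field; rewrite gt_eqF.
by rewrite ler_wpM2r ?(ltW Lc0) // ler_wpM2r ?(ltW a4) // ler_wpM2l.
Qed.

Lemma M_L_bounds :
  [/\ 0 < ML, Lf <= ML & mu 0%N * (LG * MB) <= ML].
Proof.
have [t1 t2 Lc0 Lch] := hq; have [A1 C1] := AC_ge1.
have A0 : 0 <= A := le_trans ler01 A1; have C0 : 0 <= C := le_trans ler01 C1.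
have hA' : 2 * (Lf + tau1 q) <= Lcheck q * A.
  by rewrite [leRHS]mulrC -ler_pdivrMr // le_max lexx orbT.
have hC' : 2 * mu 0%N * L (mu 0%N) <= Lcheck q * C.
  by rewrite [leRHS]mulrC -ler_pdivrMr // le_max lexx orbT.
have LA : Lcheck q * A <= ML.
  by rewrite (le_trans (ler_wpM2r A0 Lch)) // M_L_ge // ler_peMr.
have LC : Lcheck q * C <= ML.
  by rewrite (le_trans (ler_wpM2r C0 Lch)) // M_L_ge // ler_peMl.
split.
- apply: lt_le_trans LA; rewrite mulr_gt0 //; exact: lt_le_trans ltr01 A1.
- apply: le_trans LA; apply: le_trans hA'.
  by have := A_Lf hA; lra.
- apply: le_trans LC; apply: le_trans hC'.
  have h : MB * LG <= L (mu 0%N).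
    rewrite /L_ -addrA lerDl addr_ge0 //.
      by rewrite mulr_ge0 ?sqr_ge0 // (B_alpha1 hB).
    exact: divr_ge0 (mulr_ge0 (ltW (B_alpha2 hB)) (sqr_ge0 _)) (ltW mu0_gt0).
  have h0 : 0 <= mu 0%N * L (mu 0%N) by rewrite mulr_ge0 ?L_ge0 ?(ltW mu0_gt0).
  have := ler_wpM2l (ltW mu0_gt0) h; lra.
Qed.

Lemma iterate_kkt (eps1 eps2 : R) k : 0 < eps1 -> 0 < eps2 ->
  psi p (x k) - psi p (x k.+1) <= mu k * (eps1 ^+ 2 / M1) ->
  mu k <= M1 / (alpha3 s * M1 * Ml + M2 * eps1 ^+ 2) * eps2 ->
  mu k <= tau1 q * M1 / 2 * eps2 ->
  kkt_point p (x k.+1) eps1 eps2 (eps1 * Num.sqrt eps2).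
Proof.
move=> e1 e2 hdec hm1 hm2; have [x0E _ _ step] := hrun; have [sk _] := step k.
have [Ok gk] := iterate_invariant k; have [Ok1 _] := iterate_invariant k.+1.
have m0 := mu_gt0 k; have mm : mu k <= mu 0%N := mu_anti _ _ (leq0n k).
have [t1 t2 Lc0 _] := hq.
have [xi [Lfk [Lgk [lam [xis /andP[hf hf'] /andP[hg hg'] [gs mult] [_ psi']]]]]] :=
  smba_stepP _ _ _ m0 mm Ok (ltW gk) sk.
have [lam0 _ _] := mult; have [_ eb0] := eta_bar_sqr.
have lamM : lam <= Ml.
  exact: (multiplier_le _ _ _ _ _ _ _ m0 mm Ok xis hf hg gs mult _ _ eb0
    (eta_bar_le _ _ hg) hf').
have l0 : 0 <= Ml := le_trans lam0 lamM.
have [ML0 LfM LGM] := M_L_bounds.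
pose Z := Num.max (mu 0%N / tau1 q) (Ml / tau2 q).
have Z0 : 0 < Z by rewrite lt_max divr_gt0.
have M1E : M1 = 16 * ML ^+ 2 * Z by [].
set D := `|x k.+1 - x k|; have D0 : 0 <= D by exact: normr_ge0.
have dec : (tau1 q * mu k + tau2 q * lam) / (2 * mu k) * D ^+ 2 <=
    mu k * (eps1 ^+ 2 / M1).
  by move: psi' hdec; rewrite -/D; set c := _ * D ^+ 2; lra.
have c0 : 0 <= LG * MB by rewrite mulr_ge0 ?M_B_ge0 // (A_LG hA).
pose w := grad (h_of s (mu k)) (G (x k)).
have Bw : B w by exact: h_grad_base.
split; first by case: Ok1.
exists (x k), (lam *: w); split.
- by case: Ok.
- move=> y Ky; rewrite innerZl mulr_ge0_le0 //; exact: base_polar Bw _ Ky.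
- have [zeta zs hz] := kkt_residual _ _ _ _ _ _ _ m0 hf hg mult.
  apply: (@le_trans _ _ (edist (0 : X,
      zeta - xi + grad f (x k.+1) + adjoint ('d G (x k.+1)) (lam *: w)))).
    apply: ereal_inf_lbound; exists (zeta - xi + grad f (x k.+1)
      + adjoint ('d G (x k.+1)) (lam *: w)) => //.
    by exists zeta => //; exists xi.
  apply: edist0_le; apply: (le_trans hz).
  apply: (residual_le_eps1 _ _ _ _ _ _ _ _ _ _ _ m0 mm t1 t2 ML0 Z0 M1E e1 lam0
    lamM D0 dec).
  + by rewrite le_max lexx.
  + by rewrite le_max lexx orbT.
  + have lg0 : 0 <= lam * LG * MB by rewrite -mulrA mulr_ge0.
    have r0 : 0 <= lam * (Lgk / mu k).
      by rewrite mulr_ge0 // divr_ge0 ?(ltW m0) // (le_trans (ltW Lc0)).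
    exact: (addr_ge0 (addr_ge0 (addr_ge0 (ltW (A_Lf hA))
      (le_trans (ltW Lc0) hf)) lg0) r0).
  + exact: (scaled_residual_le _ _ _ _ _ _ _ _ _ _ m0 mm lam0 LfM hf' hg' LGM c0).
- have := complementarity_residual _ _ _ _ _ _ _ m0 mult; rewrite -/w -/D.
  move=> /le_trans; apply.
  (* With [N] = M_L and [c] = LG M_B, the quotient (N + m0 c) / t2 is [M2_bar]. *)
  apply: (complementarity_le_eps2 _ _ _ _ _ _ _ _ _ _ _ _ m0 mm t1 t2 ML0 Z0 M1E
    e1 lam0 lamM D0 dec _ ML) => //.
  + exact: B_alpha3 hB.
  + exact: ltW.
  + by move: hm1; rewrite /M2_bar -[_ * LG * MB]mulrA.
- rewrite -/D.
  exact: (step_le_eps3 _ _ _ _ _ _ _ _ _ _ m0 t1 t2 ML0 Z0 M1E e1 e2 lam0 D0 dec hm2).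
Qed.

Lemma kkt_exists (eps1 eps2 : R) (N : nat) : 0 < eps1 -> 0 < eps2 ->
  M1 * (psi p x0 - optval p) / eps1 ^+ 2 <= S_ mu N ->
  mu (uphalf N) <=
    Num.min (M1 / (alpha3 s * M1 * Ml + M2 * eps1 ^+ 2)) (tau1 q * M1 / 2)
    * eps2 ->
  exists k : nat, (uphalf N <= k <= N)%N /\
    kkt_point p (x k.+1) eps1 eps2 (eps1 * Num.sqrt eps2).
Proof.
move=> e1 e2 hS hmu.
have M1p : 0 < M1.
  have [ML0 _ _] := M_L_bounds; have [t1 _ _ _] := hq.
  apply: mulr_gt0; first by rewrite mulr_gt0 // exprn_gt0.
  by rewrite lt_max divr_gt0.
have upN : (uphalf N < N.+1)%N.
  rewrite ltnS uphalf_half -[leqRHS](odd_double_half N) -addnn.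
  by rewrite leq_add2l leq_addr.
(* The decrease of psi, written as an increment of - psi so that the sum telescopes. *)
pose a k := - psi p (x k.+1) - - psi p (x k).
have [k /andP[k1 k2] hk] : exists2 k, (uphalf N <= k < N.+1)%N &
    a k <= mu k * (eps1 ^+ 2 / M1).
  apply: sum_nat_exists_le => //.
  rewrite (telescope_sumr (fun k => - psi p (x k)) (ltnW upN)) -mulr_suml.
  have /andP[h1 _] := psi_optval N.+1; have /andP[_ h2] := psi_optval (uphalf N).
  apply: (@le_trans _ _ (psi p x0 - optval p)); first by lra.
  have e1sq : 0 < eps1 ^+ 2 by rewrite exprn_gt0.
  rewrite mulrA ler_pdivlMr // -ler_pdivrMr //.
  by rewrite [_ * M1]mulrC.
exists k; split; first by rewrite k1.
(* Summing only from [uphalf N] on lets the single bound on mu there cover whichever index is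
   found. *)
have mk : mu k <= mu (uphalf N) := mu_anti _ _ k1.
apply: iterate_kkt => //.
- by move: hk; rewrite /a opprK addrC.
- by apply: (le_trans mk); apply: (le_trans hmu);
    rewrite ler_wpM2r ?ge_min ?lexx // ltW.
- by apply: (le_trans mk); apply: (le_trans hmu);
    rewrite ler_wpM2r ?ge_min ?lexx ?orbT // ltW.
Qed.

End Run.

End Data.

Theorem corollary3p9 (R : realType) (X Y : finHilbertType R)
  (p : problem X Y) (Lf LG : R) (x0 : X) (B : set Y) (s : smoothing Y)
  (q : params R) (mu : nat -> R) (x : nat -> X) (eta : R) (tbar : nat)
  (eps1 eps2 : R) (K : nat)
  (hA : assumptionA p Lf LG x0)
  (hB_compact : compact B)
  (hB_base : is_base (polar (K_of p)) B)
  (hB : assumptionB B s)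
  (hC : assumptionC mu)
  (hq : valid_params q)
  (hrun : smba_run p s q x0 mu x)
  (heta : eta_spec p x0 B eta)
  (htbar : tbar_spec s mu eta tbar)
  (heps1 : 0 < eps1) (heps2 : 0 < eps2) :
  let M1 := M1_bar p Lf LG x0 B s q mu eta tbar in
  let M2 := M2_bar p Lf LG x0 B s q mu in
  let Ml := M_lambda p Lf LG x0 B s q mu eta tbar in
  M1 * (psi p x0 - optval p) / eps1 ^+ 2 <= S_ mu K ->
  mu (uphalf K) <=
    Num.min (M1 / (alpha3 s * M1 * Ml + M2 * eps1 ^+ 2)) (tau1 q * M1 / 2)
    * eps2 ->
  exists khat : nat, (uphalf K <= khat <= K)%N /\
    kkt_point p (x khat.+1) eps1 eps2 (eps1 * Num.sqrt eps2).
Proof.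
move=> M1 M2 Ml hS hmu.
have mu0_gt0 : 0 < mu 0%N by case: hrun.
exact: (kkt_exists p Lf LG x0 B s q mu hA hB_compact hB_base hB hq mu0_gt0 x eta
  tbar hrun heta htbar eps1 eps2 K).
Qed.
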